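(* Let $(F,\partial)$ be a differential field of characteristic zero with field of constants $K=C_F$, let $G$ be a linear algebraic group over $K$, and let $R/F$ be a differential ring extension. (a) Suppose that $C_R=K$. Then $R/F$ is a Picard-Vessiot ring with differential Galois group $G$ if and only if $\mathrm{Spec}(R)$ is a simple differential $G_F$-torsor. (b) Suppose that $R$ is an integral domain and that $C_{\mathrm{Frac}(R)}=K$. Then $R/F$ is a Picard-Vessiot ring with differential Galois group $G$ if and only if $\mathrm{Spec}(R)$ is a differential $G_F$-torsor.
   Context: $C_R=\{f\in R\mid\partial(f)=0\}$ denotes the constants of a differential ring $R$; $R$ is simple if it has no non-trivial ideals closed under $\partial$. A linear algebraic group over $K$ is an affine group scheme of finite type over $K$; $F[G]:=F\otimes_K K[G]$ is a differential ring extension of $F$ in which elements of $K[G]$ are constant. A $G_F$-torsor is a non-empty affine scheme $X$ of finite type over $F$ with a right $G_F$-action such that for every $F$-algebra $A$ and all $x,y\in X(A)$ there is a unique $g\in G(A)$ with $y=x.g$. A differential $G_F$-torsor is a $G_F$-torsor $X$ with an extension of $\partial$ from $F$ to $F[X]$ such that the co-action $F[X]\to F[X]\otimes_F F[G]$ is a differential homomorphism; it is simple if $F[X]$ is a simple differential ring. Saying that $\mathrm{Spec}(R)$ is a (simple) differential $G_F$-torsor means that it is one for some right $G_F$-action, with the given derivation on $R$. A Picard-Vessiot ring over $F$ is a differential ring extension $R/F$ of the form $R=F[Z,\det(Z)^{-1}]$ for some $Z\in\mathrm{GL}_n(R)$ with $\partial(Z)Z^{-1}\in F^{n\times n}$,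 such that $R$ is a simple differential ring and $C_R=K$. Its differential Galois group is the group functor $\underline{\mathrm{Aut}}^{\partial}(R/F)$ sending a $K$-algebra $A$ to the group of differential $F\otimes_K A$-automorphisms of $R\otimes_K A$ ($A$ constant); it is an affine group scheme of finite type over $K$. ''$R/F$ has differential Galois group $G$'' means that $\underline{\mathrm{Aut}}^{\partial}(R/F)$ is identified with $G$. *)

(* Defs.v *)
From HB Require Import structures.
From mathcomp Require Import all_boot all_order all_algebra.
From mathcomp Require Import ring generic_quotient boolp.

Set Implicit Arguments.
Unset Strict Implicit.
Unset Printing Implicit Defensive.

Import GRing.Theory.
Local Open Scope ring_scope.
Local Open Scope quotient_scope.

(* Algebras over a commutative ring k are commutative rings with a structure
   morphism.  Unlike comAlgType, this allows the zero ring (which must be a test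
   ring for functors of points), and makes restriction of scalars along towers
   K -> F -> R immediate. *)
Record algOver (k : comPzRingType) := AlgOver {
  algRing :> comPzRingType;
  algMap : {rmorphism k -> algRing}
}.
Arguments algMap {k} _.

Record algHom (k : comPzRingType) (A B : algOver k) := AlgHom {
  algFun :> {rmorphism A -> B};
  algFunE : forall c : k, algFun (algMap A c) = algMap B c
}.

Lemma rmorphism_ext (A B : comPzRingType) (f g : {rmorphism A -> B}) :
  f =1 g -> f = g.
Proof.
case: f g => [f [[f1] [f2]]] [g [[g1] [g2]]] /= /funext fg.
rewrite fg in f1 f2 *.
by rewrite (Prop_irrelevance f1 g1) (Prop_irrelevance f2 g2).
Qed.

Lemma algHom_ext (k : comPzRingType) (A B : algOver k) (f g : algHom A B) :
  f =1 g -> f = g.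
Proof.
case: f g => [f fP] [g gP] /= /rmorphism_ext fg.
by rewrite fg in fP *; rewrite (Prop_irrelevance fP gP).
Qed.

Section AlgHom.
Variable k : comPzRingType.
Implicit Types A B C : algOver k.

Definition selfAlg : algOver k := @AlgOver k k idfun.

Definition algId A : algHom A A :=
  @AlgHom k A A idfun (fun=> erefl).

Fact algComp_subproof A B C (g : algHom B C) (f : algHom A B) (c : k) :
  (g \o f) (algMap A c) = algMap C c.
Proof. by rewrite /= !algFunE. Qed.

Definition algComp A B C (g : algHom B C) (f : algHom A B) : algHom A C :=
  AlgHom (algComp_subproof g f).

Definition algStr A : algHom selfAlg A := @AlgHom k selfAlg A (algMap A) (fun=> erefl).

Definition generates A (P : A -> Prop) : Prop :=
  forall S : A -> Prop,
    (forall c, S (algMap A c)) ->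
    (forall x y, S x -> S y -> S (x + y)) ->
    (forall x y, S x -> S y -> S (x * y)) ->
    (forall x, P x -> S x) -> forall x, S x.

Definition finite_type A : Prop :=
  exists s : seq A, generates (fun x => x \in s).

End AlgHom.

Section Restriction.
Variables (k l : comPzRingType) (iota : {rmorphism k -> l}).

Definition resAlg (A : algOver l) : algOver k := @AlgOver k A (algMap A \o iota).

Fact resHom_subproof (A B : algOver l) (f : algHom A B) (c : k) :
  f (algMap (resAlg A) c) = algMap (resAlg B) c.
Proof. by rewrite /= algFunE. Qed.

Definition resHom (A B : algOver l) (f : algHom A B) :
  algHom (resAlg A) (resAlg B) := @AlgHom k (resAlg A) (resAlg B) f (resHom_subproof f).

End Restriction.

Section Tensor.
Variables (k : comPzRingType) (A B : algOver k).

Definition balanced (M : zmodType) (f : A -> B -> M) : Prop :=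
  [/\ forall a a' b, f (a + a') b = f a b + f a' b,
      forall a b b', f a (b + b') = f a b + f a b' &
      forall c a b, f (algMap A c * a) b = f a (algMap B c * b)].

(* A list s stands for the sum of the elementary tensors it contains.  Two sums
   are identified iff no balanced map separates them; this is the congruence
   generated by the bilinearity relations (see tlift_pure, tlift_unique). *)
Definition tens_rel (s t : seq (A * B)) : bool :=
  `[< forall (M : zmodType) (f : A -> B -> M), balanced f ->
      \sum_(p <- s) f p.1 p.2 = \sum_(p <- t) f p.1 p.2 >].

Fact tens_rel_refl : reflexive tens_rel.
Proof. by move=> s; apply/asboolP. Qed.

Fact tens_rel_sym : symmetric tens_rel.
Proof. by move=> s t; apply/asboolP/asboolP => h M f fb; rewrite h. Qed.

Fact tens_rel_trans : transitive tens_rel.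
Proof.
move=> t s u /asboolP h1 /asboolP h2; apply/asboolP => M f fb.
by rewrite h1 // h2.
Qed.

Canonical tens_equiv := EquivRel tens_rel tens_rel_refl tens_rel_sym tens_rel_trans.

Definition tens := {eq_quot tens_rel}.
HB.instance Definition _ : EqQuotient _ tens_rel tens := EqQuotient.on tens.
HB.instance Definition _ := Choice.on tens.

Definition tlift (M : zmodType) (f : A -> B -> M) (x : tens) : M :=
  \sum_(p <- repr x) f p.1 p.2.

Definition tpure (a : A) (b : B) : tens := \pi_tens [:: (a, b)].

Lemma tlift_pi (M : zmodType) (f : A -> B -> M) s :
  balanced f -> tlift f (\pi_tens s) = \sum_(p <- s) f p.1 p.2.
Proof.
move=> fb; rewrite /tlift.
have /eqmodP /asboolP h : repr (\pi_tens s) = s %[mod tens] by rewrite reprK.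
exact: h.
Qed.

Lemma tens_eqP s t :
  (forall (M : zmodType) (f : A -> B -> M), balanced f ->
      \sum_(p <- s) f p.1 p.2 = \sum_(p <- t) f p.1 p.2) ->
  \pi_tens s = \pi_tens t.
Proof. by move=> h; apply/eqmodP; apply/asboolP. Qed.

Definition tens_add (x y : tens) : tens := \pi_tens (repr x ++ repr y).
Definition tens_opp (x : tens) : tens :=
  \pi_tens [seq (- p.1, p.2) | p <- repr x].
Definition tens_zero : tens := \pi_tens [::].

Lemma tens_addE s t :
  tens_add (\pi_tens s) (\pi_tens t) = \pi_tens (s ++ t).
Proof.
by apply: tens_eqP => M f fb; rewrite !big_cat /= -!/(tlift f _) !tlift_pi.
Qed.

Lemma balanced0l (M : zmodType) (f : A -> B -> M) b : balanced f -> f 0 b = 0.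
Proof. by case=> h _ _; apply: (addrI (f 0 b)); rewrite -h !addr0. Qed.

Lemma balancedNl (M : zmodType) (f : A -> B -> M) a b :
  balanced f -> f (- a) b = - f a b.
Proof.
move=> fb; have [h _ _] := fb; apply: (addrI (f a b)).
by rewrite -h !subrr (balanced0l _ fb).
Qed.

Fact tens_addA : associative tens_add.
Proof.
elim/quotW=> x; elim/quotW=> y; elim/quotW=> z.
by rewrite (tens_addE y z) (tens_addE x y) 2!tens_addE catA.
Qed.

Fact tens_addC : commutative tens_add.
Proof.
move=> x y; rewrite -[x]reprK -[y]reprK !tens_addE.
by apply: tens_eqP => M f fb; rewrite !big_cat /= addrC.
Qed.

Fact tens_add0 : left_id tens_zero tens_add.
Proof. by move=> x; rewrite -[x]reprK tens_addE. Qed.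

Fact tens_addN : left_inverse tens_zero tens_opp tens_add.
Proof.
move=> x; rewrite -[x]reprK tens_addE; apply: tens_eqP => M f fb.
rewrite big_cat big_map big_nil /= -[X in _ + X](tlift_pi _ fb) -big_split.
by apply: big1 => p _ /=; rewrite balancedNl // addNr.
Qed.

HB.instance Definition _ :=
  GRing.isZmodule.Build tens tens_addA tens_addC tens_add0 tens_addN.

Lemma pi_cat s t : \pi_tens (s ++ t) = \pi_tens s + \pi_tens t.
Proof. by rewrite -tens_addE. Qed.

Lemma tpure_balanced : balanced tpure.
Proof.
split=> [a a' b|a b b'|c a b]; rewrite /tpure -?pi_cat; apply: tens_eqP => M f;
  by rewrite ?big_cons ?big_nil /= ?addr0; case.
Qed.

Lemma tens_sumE (x : tens) : x = \sum_(p <- repr x) tpure p.1 p.2.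
Proof.
rewrite -[LHS]reprK; elim: (repr x) => [|[a b] s IHs]; first by rewrite big_nil.
by rewrite big_cons -IHs -cat1s pi_cat.
Qed.

Lemma tens_ind (P : tens -> Prop) :
  P 0 -> (forall a b x, P x -> P (tpure a b + x)) -> forall x, P x.
Proof.
move=> P0 PS x; rewrite (tens_sumE x).
by elim: (repr x) => [|p s IHs]; rewrite ?big_nil ?big_cons //; apply: PS.
Qed.

Section Lift.
Variables (M : zmodType) (f : A -> B -> M).
Hypothesis fb : balanced f.

Lemma tlift_pure a b : tlift f (tpure a b) = f a b.
Proof. by rewrite tlift_pi // big_seq1. Qed.

Lemma tlift0 : tlift f 0 = 0.
Proof. by rewrite -[0]/(\pi_tens [::]) tlift_pi // big_nil. Qed.

Lemma tliftD x y : tlift f (x + y) = tlift f x + tlift f y.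
Proof.
rewrite -[x]reprK -[y]reprK.
by rewrite -pi_cat !tlift_pi // big_cat.
Qed.

Lemma tlift_unique (h : tens -> M) : h 0 = 0 -> {morph h : x y / x + y} ->
  (forall a b, h (tpure a b) = f a b) -> h =1 tlift f.
Proof.
move=> h0 hD hf; elim/tens_ind=> [|a b x IHx]; first by rewrite h0 tlift0.
by rewrite hD tliftD IHx hf tlift_pure.
Qed.

End Lift.

Definition tens_mul (x y : tens) : tens :=
  tlift (fun a b => tlift (fun a' b' => tpure (a * a') (b * b')) y) x.

Fact tens_mul_balr a b : balanced (fun a' b' => tpure (a * a') (b * b')).
Proof.
have [h1 h2 h3] := tpure_balanced.
split=> [a' a'' b'|a' b' b''|c a' b'].
- by rewrite mulrDr h1.
- by rewrite mulrDr h2.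
- by rewrite mulrCA h3 mulrCA.
Qed.

Fact tens_mul_ball y :
  balanced (fun a b => tlift (fun a' b' => tpure (a * a') (b * b')) y).
Proof.
have [h1 h2 h3] := tpure_balanced.
split=> [a a' b|a b b'|c a b]; rewrite /tlift -?big_split /=;
  apply: eq_bigr => p _.
- by rewrite mulrDl h1.
- by rewrite mulrDl h2.
- by rewrite -mulrA h3 mulrA.
Qed.

Lemma tens_mul_pure a b a' b' :
  tens_mul (tpure a b) (tpure a' b') = tpure (a * a') (b * b').
Proof.
by rewrite /tens_mul (tlift_pure (tens_mul_ball _)) (tlift_pure (tens_mul_balr _ _)).
Qed.

Lemma tens_mulDl : left_distributive tens_mul +%R.
Proof. by move=> x y z; rewrite /tens_mul (tliftD (tens_mul_ball _)). Qed.

Lemma tens_mul0l x : tens_mul 0 x = 0.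
Proof. exact: (tlift0 (tens_mul_ball x)). Qed.

Lemma tens_mul_purel a b y :
  tens_mul (tpure a b) y = tlift (fun a' b' => tpure (a * a') (b * b')) y.
Proof. exact: (tlift_pure (tens_mul_ball y)). Qed.

Lemma tens_mulDr : right_distributive tens_mul +%R.
Proof.
move=> x y z; elim/tens_ind: x => [|a b x IHx]; first by rewrite !tens_mul0l addr0.
by rewrite !tens_mulDl IHx !tens_mul_purel (tliftD (tens_mul_balr a b)) addrACA.
Qed.

Lemma tens_mul0r x : tens_mul x 0 = 0.
Proof. by apply: (addrI (tens_mul x 0)); rewrite -tens_mulDr !addr0. Qed.

Fact tens_mulC : commutative tens_mul.
Proof.
elim/tens_ind => [|a b x IHx] y; first by rewrite tens_mul0l tens_mul0r.
rewrite tens_mulDl tens_mulDr IHx; congr (_ + _).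
elim/tens_ind: y => [|a' b' y IHy]; first by rewrite tens_mul0l tens_mul0r.
by rewrite tens_mulDl tens_mulDr IHy !tens_mul_pure mulrC [b * _]mulrC.
Qed.

Fact tens_mulA : associative tens_mul.
Proof.
elim/tens_ind => [|a b x IHx] y z; first by rewrite !tens_mul0l.
rewrite !tens_mulDl IHx; congr (_ + _).
elim/tens_ind: y z => [|a' b' y IHy] z; first by rewrite tens_mul0r !tens_mul0l tens_mul0r.
rewrite !(tens_mulDl, tens_mulDr) IHy; congr (_ + _).
elim/tens_ind: z => [|a'' b'' z IHz]; first by rewrite !tens_mul0r.
by rewrite !tens_mulDr IHz !tens_mul_pure !mulrA.
Qed.

Fact tens_mul1 : left_id (tpure 1 1) tens_mul.
Proof.
elim/tens_ind => [|a b x IHx]; first by rewrite tens_mul0r.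
by rewrite tens_mulDr IHx tens_mul_pure !mul1r.
Qed.

HB.instance Definition _ := GRing.Zmodule_isComPzRing.Build tens
  tens_mulA tens_mulC tens_mul1 tens_mulDl.

Lemma tpureM a b a' b' :
  tpure a b * tpure a' b' = tpure (a * a') (b * b').
Proof. exact: tens_mul_pure. Qed.

Definition tinl (a : A) : tens := tpure a 1.
Definition tinr (b : B) : tens := tpure 1 b.

Fact tinl_zmod : zmod_morphism tinl.
Proof.
move=> a a'; have [h _ _] := tpure_balanced.
by rewrite /tinl h balancedNl //; exact: tpure_balanced.
Qed.
Fact tinl_monoid : monoid_morphism tinl.
Proof. by split=> // a a'; rewrite /tinl tpureM mul1r. Qed.
HB.instance Definition _ := GRing.isZmodMorphism.Build A tens tinl tinl_zmod.
HB.instance Definition _ := GRing.isMonoidMorphism.Build A tens tinl tinl_monoid.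

Fact tinr_zmod : zmod_morphism tinr.
Proof.
move=> b b'; have [_ h _] := tpure_balanced.
by apply/eqP; rewrite eq_sym subr_eq -h subrK.
Qed.
Fact tinr_monoid : monoid_morphism tinr.
Proof. by split=> // a a'; rewrite /tinr tpureM mul1r. Qed.
HB.instance Definition _ := GRing.isZmodMorphism.Build B tens tinr tinr_zmod.
HB.instance Definition _ := GRing.isMonoidMorphism.Build B tens tinr tinr_monoid.

Definition tensAlg : algOver k := @AlgOver k tens (tinl \o algMap A).

Definition tensInl : algHom A tensAlg := @AlgHom k A tensAlg tinl (fun=> erefl).

Fact tinr_str c : tinr (algMap B c) = algMap tensAlg c.
Proof.
have [_ _ h] := tpure_balanced.
by rewrite /= /tinr /tinl -[algMap B c]mulr1 -h mulr1.
Qed.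
Definition tensInr : algHom B tensAlg := @AlgHom k B tensAlg tinr tinr_str.

Lemma tpureE a b : tpure a b = tensInl a * tensInr b.
Proof. by rewrite /= tpureM mulr1 mul1r. Qed.

End Tensor.

Section TensorMap.
Variables (k : comPzRingType) (A B A' B' : algOver k).
Variables (f : algHom A A') (g : algHom B B').

Definition tmap (x : tens A B) : tens A' B' := tlift (fun a b => tpure (f a) (g b)) x.

Fact tmap_balanced : balanced (fun a b => tpure (f a) (g b)).
Proof.
have [h1 h2 h3] := tpure_balanced A' B'.
by split=> [a a' b|a b b'|c a b];
  rewrite ?rmorphD ?h1 ?h2 // !rmorphM /= !algFunE h3.
Qed.

Fact tmap_zmod : zmod_morphism tmap.
Proof.
move=> x y; rewrite /tmap; apply/eqP; rewrite eq_sym subr_eq.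
by rewrite -(tliftD tmap_balanced) subrK.
Qed.

Lemma tmap_pure a b : tmap (tpure a b) = tpure (f a) (g b).
Proof. exact: (tlift_pure tmap_balanced). Qed.

HB.instance Definition _ :=
  GRing.isZmodMorphism.Build (tens A B) (tens A' B') tmap tmap_zmod.

Fact tmap_monoid : monoid_morphism tmap.
Proof.
split=> [|x y]; first by rewrite -[1]/(tpure 1 1) tmap_pure !rmorph1.
elim/tens_ind: x y => [|a b x IHx] y; first by rewrite mul0r !raddf0 mul0r.
rewrite mulrDl !raddfD /= mulrDl IHx; congr (_ + _).
elim/tens_ind: y => [|a' b' y IHy]; first by rewrite mulr0 !raddf0 mulr0.
by rewrite mulrDr !raddfD /= mulrDr IHy tpureM !tmap_pure tpureM !rmorphM.
Qed.

HB.instance Definition _ :=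
  GRing.isMonoidMorphism.Build (tens A B) (tens A' B') tmap tmap_monoid.

Fact tmap_str c : tmap (algMap (tensAlg A B) c) = algMap (tensAlg A' B') c.
Proof. by rewrite /= tmap_pure rmorph1 algFunE. Qed.

Definition tensMap : algHom (tensAlg A B) (tensAlg A' B') :=
  @AlgHom k (tensAlg A B) (tensAlg A' B') tmap tmap_str.

End TensorMap.

Record derivation (A : comPzRingType) := Derivation {
  derFun :> A -> A;
  derD : {morph derFun : x y / x + y};
  derM : forall x y, derFun (x * y) = derFun x * y + x * derFun y
}.

Section ZeroDerivation.
Variable A : comPzRingType.
Let zero (x : A) : A := 0.
Fact der0D : {morph zero : x y / x + y}.
Proof. by move=> x y; rewrite /zero addr0. Qed.
Fact der0M x y : zero (x * y) = zero x * y + x * zero y.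
Proof. by rewrite /zero mul0r mulr0 addr0. Qed.
Definition der0 : derivation A := Derivation der0D der0M.
End ZeroDerivation.

Section DerivationTheory.
Variables (A : comPzRingType) (d : derivation A).

Lemma der_0 : d 0 = 0.
Proof. by apply: (addrI (d 0)); rewrite -derD !addr0. Qed.

Lemma der_1 : d 1 = 0.
Proof.
apply: (addrI (d 1)); rewrite addr0.
by have := derM d 1 1; rewrite !mulr1 mul1r.
Qed.

Lemma derN x : d (- x) = - d x.
Proof. by apply: (addrI (d x)); rewrite -derD !subrr der_0. Qed.

End DerivationTheory.

(* The base ring k carries the derivation dk. *)
Record diffAlg (k : comPzRingType) (dk : derivation k) := DiffAlg {
  diffAlgOver :> algOver k;
  der : derivation diffAlgOver;
  derMap : forall c : k, der (algMap diffAlgOver c) = algMap diffAlgOver (dk c)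
}.
Arguments der {k dk} _.

Definition mkDiffAlg (k : comPzRingType) (dk : derivation k) (A : comPzRingType)
    (dA : derivation A) (i : {rmorphism k -> A})
    (iP : forall c, dA (i c) = i (dk c)) : diffAlg dk :=
  @DiffAlg k dk (AlgOver i) dA iP.

Definition selfDiffAlg (k : comPzRingType) (dk : derivation k) : diffAlg dk :=
  @DiffAlg k dk (selfAlg k) dk (fun=> erefl).

Fact constDiffAlg_subproof (k : comPzRingType) (A : algOver k) (c : k) :
  der0 A (algMap A c) = algMap A (der0 k c).
Proof. by rewrite /= rmorph0. Qed.

Definition constDiffAlg (k : comPzRingType) (A : algOver k) : diffAlg (der0 k) :=
  DiffAlg (@constDiffAlg_subproof k A).

Section DiffRestriction.
Variables (k l : comPzRingType) (dl : derivation l) (iota : {rmorphism k -> l}).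
Hypothesis iota_const : forall c, dl (iota c) = 0.

Fact resDiffAlg_subproof (A : diffAlg dl) (c : k) :
  der A (algMap (resAlg iota A) c) = algMap (resAlg iota A) (der0 k c).
Proof. by rewrite /= derMap iota_const !rmorph0. Qed.

Definition resDiffAlg (A : diffAlg dl) : diffAlg (der0 k) :=
  @DiffAlg k (der0 k) (resAlg iota A) (der A) (resDiffAlg_subproof A).

End DiffRestriction.

Section DiffTensor.
Variables (k : comPzRingType) (dk : derivation k) (A B : diffAlg dk).

Definition tens_der (x : tens A B) : tens A B :=
  tlift (fun a b => tpure (der A a) b + tpure a (der B b)) x.

Fact tens_der_balanced :
  balanced (fun (a : A) (b : B) => tpure (der A a) b + tpure a (der B b)).
Proof.
have [h1 h2 h3] := tpure_balanced A B.
split=> [a a' b|a b b'|c a b]; rewrite ?derD ?h1 ?h2; first by rewrite addrACA.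
  by rewrite addrACA.
by rewrite !derM !derMap h1 h2 !h3 addrA; congr (_ + _); rewrite addrC.
Qed.

Lemma tens_der_pure a b :
  tens_der (tpure a b) = tpure (der A a) b + tpure a (der B b).
Proof. exact: (tlift_pure tens_der_balanced). Qed.

Fact tens_derD : {morph tens_der : x y / x + y}.
Proof. exact: (tliftD tens_der_balanced). Qed.

Fact tens_derM x y : tens_der (x * y) = tens_der x * y + x * tens_der y.
Proof.
have d0 : tens_der 0 = 0 := tlift0 tens_der_balanced.
have [h1 h2 _] := tpure_balanced A B.
elim/tens_ind: x y => [|a b x IHx] y; first by rewrite !(d0, mul0r) addr0.
rewrite mulrDl !tens_derD IHx !mulrDl [RHS]addrACA; congr (_ + _).
elim/tens_ind: y => [|a' b' y IHy]; first by rewrite !(d0, mulr0) addr0.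
rewrite mulrDr !tens_derD IHy !mulrDr [RHS]addrACA; congr (_ + _).
rewrite !tpureM !tens_der_pure !mulrDl !mulrDr !tpureM !derM !h1 !h2.
by rewrite addrACA.
Qed.

Definition tensDer : derivation (tens A B) := Derivation tens_derD tens_derM.

Fact tensDiff_subproof c :
  tensDer (algMap (tensAlg A B) c) = algMap (tensAlg A B) (dk c).
Proof.
have [_ h _] := tpure_balanced A B.
rewrite /= tens_der_pure derMap der_1.
suff -> : tpure (algMap A c) (0 : B) = 0 by rewrite addr0.
by apply: (addrI (tpure (algMap A c) 0)); rewrite -h !addr0.
Qed.

Definition tensDiffAlg : diffAlg dk :=
  @DiffAlg k dk (tensAlg A B) tensDer tensDiff_subproof.

Fact baseDiff_subproof (a : A) : tensDer (@tinl k A B a) = tinl B (der A a).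
Proof.
have [_ h _] := tpure_balanced A B.
rewrite /= /tinl tens_der_pure der_1.
suff -> : tpure a (0 : B) = 0 by rewrite addr0.
by apply: (addrI (tpure a 0)); rewrite -h !addr0.
Qed.

(* The same differential ring, viewed as an algebra over its left factor A. *)
Definition baseDiffAlg : diffAlg (der A) :=
  @DiffAlg A (der A) (@AlgOver A (tens A B) (@tinl k A B)) tensDer baseDiff_subproof.

End DiffTensor.

(* An affine group scheme of finite type, as a group-valued functor
   A |-> Hom_k(k[G], A) represented by a finitely generated algebra k[G]. *)
Record linAlgGroup (k : comPzRingType) := LinAlgGroup {
  coordRing : algOver k;
  coordRing_ft : finite_type coordRing;
  gmul : forall A : algOver k,
    algHom coordRing A -> algHom coordRing A -> algHom coordRing A;
  gone : forall A : algOver k, algHom coordRing A;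
  ginv : forall A : algOver k, algHom coordRing A -> algHom coordRing A;
  gmulA : forall A, associative (@gmul A);
  gmul1 : forall A, left_id (@gone A) (@gmul A);
  gmulV : forall A, left_inverse (@gone A) (@ginv A) (@gmul A);
  gmul_nat : forall (A B : algOver k) (f : algHom A B) (g h : algHom coordRing A),
    algComp f (gmul g h) = gmul (algComp f g) (algComp f h)
}.
Arguments gmul {k} _ {A} _ _.
Arguments gone {k} _ _.

Section Constants.
Variables (F : fieldType) (d : derivation F).

Definition is_const : {pred F} := fun x => d x == 0.

Lemma is_constE x : (x \in is_const) = (d x == 0).
Proof. by []. Qed.

Fact is_const_divring : divring_closed is_const.
Proof.
split=> [|x y|x y]; rewrite !is_constE ?der_1 //.
  by move=> /eqP dx /eqP dy; rewrite derD derN dx dy subr0.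
move=> /eqP dx /eqP dy; rewrite derM dx mul0r add0r.
have [->|y0] := eqVneq y 0; first by rewrite invr0 der_0 mulr0.
suff -> : d y^-1 = 0 by rewrite mulr0.
apply: (mulfI y0); rewrite mulr0.
by have := derM d y y^-1; rewrite divff // der_1 dy mul0r add0r.
Qed.

HB.instance Definition _ := GRing.isDivringClosed.Build F is_const is_const_divring.

(* The field of constants C_F of (F, d). *)
Record constField := ConstField { constVal :> F; constValP : constVal \in is_const }.

HB.instance Definition _ := [isSub for constVal].
HB.instance Definition _ := [Choice of constField by <:].
HB.instance Definition _ := [SubChoice_isSubIntegralDomain of constField by <:].
HB.instance Definition _ := [SubIntegralDomain_isSubField of constField by <:].

Definition constIncl : {rmorphism constField -> F} := (\val : constField -> F).

Fact constInclP (c : constField) : d (constIncl c) = 0.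
Proof. by apply/eqP; case: c. Qed.

End Constants.

Section FractionDerivation.
Variables (R : idomainType) (d : derivation R).
Notation "x %:F" := (@FracField.tofrac R x).

(* The quotient rule. *)
Definition frac_der (x : {fraction R}) : {fraction R} :=
  let n := \n_(repr x) in let e := \d_(repr x) in
  (d n * e - n * d e)%:F / (e ^+ 2)%:F.

Lemma fracE (x : {fraction R}) : x = (\n_(repr x))%:F / (\d_(repr x))%:F.
Proof.
have e0 : (\d_(repr x))%:F != 0 by rewrite tofrac_eq0 denom_ratioP.
apply: (mulIf e0); rewrite divfK //; set y := repr x.
rewrite -[x]reprK -/y; unlock FracField.tofrac.
rewrite -[LHS]FracField.pi_mul; apply/eqmodP.
rewrite /= FracField.equivfE /FracField.mulf.
by rewrite !numden_Ratio ?(mulf_neq0, denom_ratioP, oner_neq0) // !mulr1 mulrC.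
Qed.

Lemma frac_derE n e : e != 0 ->
  frac_der (n%:F / e%:F) = (d n * e - n * d e)%:F / (e ^+ 2)%:F.
Proof.
move=> e0; rewrite /frac_der; set x := n%:F / e%:F.
set n' := \n_(repr x); set e' := \d_(repr x).
have e'0 : e' != 0 by exact: denom_ratioP.
have nz a : a != 0 -> a%:F != 0 by rewrite tofrac_eq0.
have E : n * e' = n' * e.
  apply/eqP; rewrite -tofrac_eq !tofracM -eqr_div ?nz //; apply/eqP.
  exact: fracE.
have dE : d n * e' + n * d e' = d n' * e + n' * d e by rewrite -!derM E.
apply/eqP; rewrite eqr_div ?nz ?expf_neq0 // -!tofracM tofrac_eq; apply/eqP.
have -> : (d n' * e' - n' * d e') * e ^+ 2 =
  e * e' * (d n' * e + n' * d e) - (n' * e) * (e' * d e + e * d e').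
  by rewrite !expr2; ring.
by rewrite -dE -E !expr2; ring.
Qed.

Fact frac_derD : {morph frac_der : x y / x + y}.
Proof.
move=> x y; rewrite [x]fracE [y]fracE.
set a := \n_(repr x); set b := \d_(repr x).
set a' := \n_(repr y); set b' := \d_(repr y).
have b0 : b != 0 by exact: denom_ratioP.
have b'0 : b' != 0 by exact: denom_ratioP.
have nz c : c != 0 -> c%:F != 0 by rewrite tofrac_eq0.
rewrite addf_div ?nz // -!tofracM -tofracD !frac_derE ?mulf_neq0 //.
rewrite addf_div ?nz ?expf_neq0 // -!tofracM -tofracD.
apply/eqP; rewrite eqr_div ?nz ?mulf_neq0 ?expf_neq0 // -!tofracM tofrac_eq.
by apply/eqP; rewrite !derD !derM !expr2; ring.
Qed.

Fact frac_derM x y : frac_der (x * y) = frac_der x * y + x * frac_der y.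
Proof.
rewrite [x]fracE [y]fracE.
set a := \n_(repr x); set b := \d_(repr x).
set a' := \n_(repr y); set b' := \d_(repr y).
have b0 : b != 0 by exact: denom_ratioP.
have b'0 : b' != 0 by exact: denom_ratioP.
have nz c : c != 0 -> c%:F != 0 by rewrite tofrac_eq0.
rewrite mulf_div -!tofracM !frac_derE ?mulf_neq0 // !mulf_div -!tofracM.
rewrite addf_div ?nz ?mulf_neq0 ?expf_neq0 // -!tofracM -tofracD.
apply/eqP; rewrite eqr_div ?nz ?mulf_neq0 ?expf_neq0 // -!tofracM tofrac_eq.
by apply/eqP; rewrite !derM !expr2; ring.
Qed.

Definition fracDer : derivation {fraction R} := Derivation frac_derD frac_derM.

Lemma fracDer_tofrac x : fracDer x%:F = (d x)%:F.
Proof.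
have -> : x%:F = x%:F / 1%:F by rewrite tofrac1 divr1.
by rewrite /= frac_derE ?oner_eq0 // der_1 mulr0 subr0 mulr1 expr1n tofrac1 divr1.
Qed.

End FractionDerivation.

Section FractionAlgebra.
Variables (k : comPzRingType) (dk : derivation k) (R : idomainType).
Variables (dR : derivation R) (i : {rmorphism k -> R}).
Hypothesis iP : forall c, dR (i c) = i (dk c).

Fact fracDiffAlg_subproof (c : k) :
  fracDer dR ((@FracField.tofrac R \o i) c) = (@FracField.tofrac R \o i) (dk c).
Proof. by rewrite /= -iP -fracDer_tofrac. Qed.

Definition fracDiffAlg : diffAlg dk :=
  @mkDiffAlg k dk {fraction R} (fracDer dR) (@FracField.tofrac R \o i)
    fracDiffAlg_subproof.

End FractionAlgebra.

Definition simple_diff (A : comPzRingType) (d : derivation A) : Prop :=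
  forall I : A -> Prop,
    I 0 -> (forall x y, I x -> I y -> I (x + y)) ->
    (forall a x, I x -> I (a * x)) -> (forall x, I x -> I (d x)) ->
    (forall x, I x -> x = 0) \/ (forall x, I x).

Section PicardVessiot.
Variables (F : fieldType) (d : derivation F).
Notation K := (constField d).
Notation resK := (resAlg (constIncl d)).
Notation resHomK := (resHom (constIncl d)).
Notation resDK := (resDiffAlg (@constInclP F d)).

(* C_R = K, where K is identified with its image in R *)
Definition constants_eq_K (R : diffAlg d) : Prop :=
  forall x : R, der R x = 0 <-> exists c : K, x = algMap R (constIncl d c).

Definition picard_vessiot (R : diffAlg d) : Prop :=
  [/\ exists n : nat, exists Z W : 'M[R]_n, exists u : R,
        [/\ (0 < n)%N /\ Z *m W = 1%:M /\ W *m Z = 1%:M,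
            exists A : 'M[F]_n, map_mx (der R) Z *m W = map_mx (algMap R) A,
            u * \det Z = 1 &
            generates (fun x => (exists i j, x = Z i j) \/ x = u)],
      simple_diff (der R) &
      constants_eq_K R].

Section AutFunctor.
Variable R : diffAlg d.

(* R (x)_K A and F (x)_K A, with A constant, and the structure morphism of the
   former over the latter. *)
Definition RtensA (A : algOver K) : diffAlg (der0 K) :=
  tensDiffAlg (resDK R) (constDiffAlg A).
Definition FtensA (A : algOver K) : diffAlg (der0 K) :=
  tensDiffAlg (resDK (selfDiffAlg d)) (constDiffAlg A).
Definition FtensA_RtensA (A : algOver K) : algHom (FtensA A) (RtensA A) :=
  tensMap (resHomK (algStr R)) (algId A).

Record diffAut (A : algOver K) := DiffAut {
  autFun :> {rmorphism RtensA A -> RtensA A};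
  aut_bij : bijective autFun;
  aut_der : forall x, autFun (der (RtensA A) x) = der (RtensA A) (autFun x);
  aut_lin : forall y : FtensA A, autFun (FtensA_RtensA A y) = FtensA_RtensA A y
}.

Lemma diffAut_ext (A : algOver K) (s t : diffAut A) : s =1 t -> s = t.
Proof.
case: s t => [s s1 s2 s3] [t t1 t2 t3] /= /rmorphism_ext st.
rewrite st in s1 s2 s3 *.
by rewrite (Prop_irrelevance s1 t1) (Prop_irrelevance s2 t2) (Prop_irrelevance s3 t3).
Qed.

Definition RtensMap (A B : algOver K) (f : algHom A B) :
  algHom (RtensA A) (RtensA B) := tensMap (algId (resK R)) f.

(* An isomorphism of group functors G -> Aut(R/F).  Since R (x) B is generated by
   the image of R (x) A together with F (x) B, the last clause says that
   theta (f o g) is the base change of theta g along f. *)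
Definition galois_group (G : linAlgGroup K) : Prop :=
  exists theta : forall A : algOver K, algHom (coordRing G) A -> diffAut A,
    [/\ forall A, bijective (theta A),
        forall A (g h : algHom (coordRing G) A) x,
          theta A (gmul G g h) x = theta A g (theta A h x) &
        forall A B (f : algHom A B) (g : algHom (coordRing G) A) x,
          theta B (algComp f g) (RtensMap f x) = RtensMap f (theta A g x)].

End AutFunctor.

Section Torsor.
Variable G : linAlgGroup K.

(* A right action of G_F on Spec X; note G_F(A) = G(A) for every F-algebra A. *)
Record rightAction (X : algOver F) := RightAction {
  act : forall A : algOver F,
    algHom X A -> algHom (coordRing G) (resK A) -> algHom X A;
  act1 : forall (A : algOver F) (x : algHom X A), act x (gone G (resK A)) = x;
  actM : forall (A : algOver F) (x : algHom X A) (g h : algHom (coordRing G) (resK A)),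
    act x (gmul G g h) = act (act x g) h;
  act_nat : forall (A B : algOver F) (f : algHom A B) (x : algHom X A)
      (g : algHom (coordRing G) (resK A)),
    algComp f (act x g) = act (algComp f x) (algComp (resHomK f) g)
}.

Definition torsor (X : algOver F) (a : rightAction X) : Prop :=
  [/\ (1 : X) != 0, finite_type X &
      forall (A : algOver F) (x y : algHom X A), exists! g, y = act a x g].

(* F[G] = F (x)_K K[G], the elements of K[G] being constant. *)
Definition FG : diffAlg d :=
  baseDiffAlg (resDK (selfDiffAlg d)) (constDiffAlg (coordRing G)).

Definition FG_incl : algHom (coordRing G) (resK FG) :=
  @AlgHom K (coordRing G) (resK FG)
    (@tinr K (resK (selfAlg F)) (coordRing G))
    (@tinr_str K (resK (selfAlg F)) (coordRing G)).

(* The co-action F[X] -> F[X] (x)_F F[G] is the translate of the tautological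
   point of X by the tautological point of G. *)
Definition coaction (X : diffAlg d) (a : rightAction X) :
  algHom X (tensDiffAlg X FG) :=
  act a (tensInl X FG) (algComp (resHomK (tensInr X FG)) FG_incl).

Definition diff_torsor (X : diffAlg d) : Prop :=
  exists a : rightAction X,
    torsor a /\ forall x : X, coaction a (der X x) = der (tensDiffAlg X FG) (coaction a x).

Definition simple_diff_torsor (X : diffAlg d) : Prop :=
  diff_torsor X /\ simple_diff (der X).

End Torsor.

End PicardVessiot.

(* Main.v *)
(* The torsor condition says that R (x)_F R is isomorphic to R (x)_K K[G], the
   elements of K[G] becoming constants of R (x)_F R.  Throughout, the key fact is
   that if R is a simple differential ring with constants K, then every
   d-stable R-submodule N of R (x)_K B, with B constant, is spanned by the
   elements b of B such that 1 (x) b lies in N.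

   If R is a Picard-Vessiot ring with fundamental matrix Z, this fact and the
   constancy of (Z (x) 1)^-1 (1 (x) Z) identify R (x)_F R with R (x)_K C, for C
   its ring of constants.  So a pair of points x, y of R in an F-algebra A yields
   a differential automorphism of R (x)_K A, that is, a point of G carrying x to
   y.

   Conversely, let Spec R be a simple torsor.  Right translation identifies G
   with Aut(R/F), as the constants of R (x)_K A are A.  Every element of R lies
   in a finite-dimensional d-stable F-subspace V of R, because R (x)_F R is
   generated by constants; by the key fact applied to R (x)_F V inside
   R (x)_K K[G], the space V has a fundamental matrix over R, and R is generated
   by that of a large enough V.

   If R is a domain and Frac(R) has constants K, the key fact over Frac(R) shows
   that a nonzero differential ideal of R corresponds to an ideal of K[G] which,
   after translation, contains 1. *)
From HB Require Import structures.
Require Import Defs.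
From mathcomp Require Import all_boot all_order all_algebra.
From mathcomp Require Import ring boolp classical_sets.

Set Implicit Arguments.
Unset Strict Implicit.
Unset Printing Implicit Defensive.

Import GRing.Theory.
Local Open Scope ring_scope.

(** * Linear forms over a field *)

Section LinearForms.
Variables (k : fieldType) (B : algOver k).
Implicit Types (S J : B -> Prop) (phi : B -> k).

Definition subspace S : Prop :=
  [/\ S 0, forall x y, S x -> S y -> S (x + y) &
      forall c x, S x -> S (algMap B c * x)].

Definition linform phi : Prop :=
  {morph phi : x y / x + y} /\ forall c x, phi (algMap B c * x) = c * phi x.

Lemma subspaceN S x : subspace S -> S x -> S (- x).
Proof. by case=> _ _ h /(h (-1)); rewrite rmorphN1 mulN1r. Qed.

Lemma subspaceB S x y : subspace S -> S x -> S y -> S (x - y).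
Proof. by move=> Ss Sx /(subspaceN Ss); case: Ss => _ h _; apply: h. Qed.

Lemma subspace_sum S (I : Type) (r : seq I) (P : pred I) (f : I -> B) :
  subspace S -> (forall i, P i -> S (f i)) -> S (\sum_(i <- r | P i) f i).
Proof. by case=> S0 SD _ Sf; elim/big_ind: _. Qed.

Lemma subspace0 : subspace (fun x : B => x = 0).
Proof. by split=> // [x y -> ->|c x ->]; rewrite ?addr0 ?mulr0. Qed.

Lemma linform0 phi : linform phi -> phi 0 = 0.
Proof. by case=> h _; apply: (addrI (phi 0)); rewrite -h !addr0. Qed.

Lemma linformB phi : linform phi -> {morph phi : x y / x - y}.
Proof.
case=> hD hZ x y; rewrite hD -[- y]mulN1r -(rmorphN1 (algMap B)) hZ.
by rewrite mulN1r.
Qed.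

Lemma linform_sum phi (I : Type) (r : seq I) (P : pred I) (f : I -> B) :
  linform phi -> phi (\sum_(i <- r | P i) f i) = \sum_(i <- r | P i) phi (f i).
Proof. by move=> h; rewrite (big_morph phi h.1 (linform0 h)). Qed.

(* A subspace maximal among those containing S but not b has codimension one. *)
Lemma separation S b : subspace S -> ~ S b ->
  exists phi, [/\ linform phi, forall x, S x -> phi x = 0 & phi b = 1].
Proof.
(* Zorn's lemma also covers the empty chain, whose union is the empty set; adjoining S in [U] makes
   that case the subspace S itself. *)
move=> Ss Sb; pose U (A : set B) x := A x \/ S x.
have [A [[AV Ab] Amax]] : exists A, (subspace (U A) /\ ~ U A b) /\
    forall A', (A `<` A')%classic -> ~ (subspace (U A') /\ ~ U A' b).
  apply: (@Zorn_bigcup B (fun A => subspace (U A) /\ ~ U A b)) => C CP Ctot.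
  have sub (X : set B) x : C X -> U X x -> U (\bigcup_(Y in C) Y)%classic x.
    by move=> CX [Xx|Sx]; [left; exists X|right].
  have stable x : S x -> U (\bigcup_(Y in C) Y)%classic x by right.
  split; last by case=> [[X CX Xb]|//]; case: (CP X CX) => _; apply; left.
  split=> [|x y|c x [[X CX Xx]|Sx]]; first by apply: stable; case: Ss.
  - case=> [[X CX Xx]|Sx] [[Y CY Yy]|Sy].
    + case: (Ctot X Y CX CY) => XY.
        apply: (sub Y) => //; case: (CP Y CY) => [[_ h _] _].
        by apply: h; left=> //; apply: XY.
      apply: (sub X) => //; case: (CP X CX) => [[_ h _] _].
      by apply: h; left=> //; apply: XY.
    + apply: (sub X) => //; case: (CP X CX) => [[_ h _] _].
      by apply: h; [left|right].
    + apply: (sub Y) => //; case: (CP Y CY) => [[_ h _] _].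
      by apply: h; [right|left].
    + by apply: stable; case: Ss => _ h _; apply: h.
  - by apply: (sub X) => //; case: (CP X CX) => [[_ _ h] _]; apply: h; left.
  - by apply: stable; case: Ss => _ _ h; apply: h.
have coord x : {c : k | U A (x - algMap B c * b)}.
  apply: cid; have [Ux|nUx] := pselect (U A x).
    by exists 0; rewrite rmorph0 mul0r subr0.
  (* [A'] is the span of [U A] and x. By maximality it contains b, so b - c x lies in [U A] for some
     c. This c is nonzero because b is not in [U A], and the relation can be solved for x. *)
  pose A' : set B := fun y => exists c, U A (y - algMap B c * x).
  have AA' y : U A y -> A' y by exists 0; rewrite rmorph0 mul0r subr0.
  have UA' y : U A' y -> A' y by case=> // Sy; apply: AA'; right.
  have A's : subspace (U A').
    split=> [|y z /UA' [c hy] /UA' [e hz]|c y /UA' [e hy]]; left.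
    - by apply: AA'; case: AV.
    - exists (c + e); case: AV => _ h _; move: (h _ _ hy hz).
      by congr (U A _); rewrite rmorphD; ring.
    - exists (c * e); case: AV => _ _ h; move: (h c _ hy).
      by congr (U A _); rewrite rmorphM; ring.
  have strict : (A `<` A')%classic.
    split=> [y Ay|/(_ x)]; first by apply: AA'; left.
    have A'x : A' x by exists 1; rewrite rmorph1 mul1r subrr; case: AV.
    by move=> /(_ A'x) Ax; apply: nUx; left.
  have := Amax _ strict; rewrite not_andP; case=> // /contrapT /UA' [c hb].
  have c0 : c != 0.
    by apply: contra_notN Ab => /eqP c0; move: hb; rewrite c0 rmorph0 mul0r subr0.
  exists c^-1; case: AV => _ _ h; move: (h (- c^-1) _ hb); congr (U A _).
  have -> : algMap B (- c^-1) * (b - algMap B c * x) =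
    (algMap B c^-1 * algMap B c) * x - algMap B c^-1 * b by rewrite rmorphN; ring.
  by rewrite -rmorphM mulVf // rmorph1 mul1r.
have coord_uniq x c e : U A (x - algMap B c * b) -> U A (x - algMap B e * b) -> c = e.
  move=> hc he; apply/eqP; rewrite -subr_eq0; apply: contraT => ce.
  case: Ab; have := subspaceB AV he hc; case: AV => _ _ h /(h (c - e)^-1).
  have -> : (x - algMap B e * b) - (x - algMap B c * b) = algMap B (c - e) * b.
    by rewrite rmorphB; ring.
  by rewrite mulrA -rmorphM mulVf // rmorph1 mul1r.
pose phi x := sval (coord x); have phiP x : U A (x - algMap B (phi x) * b) := svalP (coord x).
exists phi; split.
- have [_ hD hZ] := AV; split=> [x y|c x]; apply: (coord_uniq _ _ _ (phiP _)).
    by move: (hD _ _ (phiP x) (phiP y)); congr (U A _); rewrite rmorphD; ring.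
  by move: (hZ c _ (phiP x)); congr (U A _); rewrite rmorphM; ring.
- move=> x Sx; apply: (coord_uniq _ _ _ (phiP _)).
  by rewrite rmorph0 mul0r subr0; right.
- apply: (coord_uniq _ _ _ (phiP _)).
  by rewrite rmorph1 mul1r subrr; case: AV.
Qed.

(** Induction on s: the residue of a new element, once its components along the [w i] are removed,
    either lies in J or is adjoined to w together with a form obtained by separation. The clause
    over all S says that each [w i] lies in the span of s. *)
Lemma dual_basis J (s : seq B) : subspace J ->
  exists (n : nat) (w : 'I_n -> B) (phi : 'I_n -> B -> k),
  [/\ forall i, linform (phi i) /\ forall x, J x -> phi i x = 0,
      forall i j, phi i (w j) = (i == j)%:R,
      forall i S, subspace S -> (forall b, b \in s -> S b) -> S (w i) &
      forall b, b \in s -> J (b - \sum_i algMap B (phi i b) * w i)].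
Proof.
move=> Js; elim: s => [|b s [n [w [phi [phiP dual span expand]]]]].
  by exists 0%N, (fun=> 0), (fun _ _ => 0); split=> // [[]|[]|[]].
pose res x := x - \sum_i algMap B (phi i x) * w i.
have phires i x : phi i (res x) = 0.
  have [hi _] := phiP i; rewrite /res linformB // linform_sum //.
  rewrite (bigD1 i) //= hi.2 dual eqxx mulr1 big1 ?addr0 ?subrr // => j ji.
  by rewrite hi.2 dual eq_sym (negbTE ji) mulr0.
have spanres i S : subspace S -> (forall y, y \in b :: s -> S y) -> S (w i).
  by move=> Ss Sb; apply: span => // y ys; apply: Sb; rewrite inE ys orbT.
have [Jb|Jb] := pselect (J (res b)).
  exists n, w, phi; split=> // x; rewrite inE => /predU1P [->|] //.
  exact: expand.
(* T is J plus the span of the [w i], so a form separating [res b] from T vanishes on J and on every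
   old basis vector. *)
pose T x := J (res x).
have resD x y : res (x + y) = res x + res y.
  rewrite /res addrACA -opprD -big_split; congr (_ - _); apply: eq_bigr => i _.
  by rewrite (phiP i).1.1 rmorphD mulrDl.
have resZ c x : res (algMap B c * x) = algMap B c * res x.
  rewrite /res mulrBr mulr_sumr; congr (_ - _); apply: eq_bigr => i _.
  by rewrite (phiP i).1.2 rmorphM mulrA.
have resE x : (forall i, phi i x = 0) -> res x = x.
  by move=> h; rewrite /res big1 ?subr0 // => i _; rewrite h rmorph0 mul0r.
have res0 : res 0 = 0 by apply: (addrI (res 0)); rewrite -resD !addr0.
have Ts : subspace T.
  case: Js => J0 JD JZ; rewrite /T; split=> [|x y|c x]; first by rewrite res0.
    by rewrite resD; apply: JD.
  by rewrite resZ; apply: JZ.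
have nTb : ~ T (res b) by rewrite /T (resE (res b)).
have [psi [psiP psi0 psi1]] := separation Ts nTb.
have JT x : J x -> T x by move=> Jx; rewrite /T resE // => i; apply: (phiP i).2.
have Tw i : T (w i).
  rewrite /T /res (bigD1 i) //= dual eqxx rmorph1 mul1r big1 ?addr0 ?subrr.
    by case: Js.
  by move=> j ji; rewrite dual (negbTE ji) rmorph0 mul0r.
pose w' (i : 'I_n.+1) := if unlift ord0 i is Some j then w j else res b.
pose phi' (i : 'I_n.+1) := if unlift ord0 i is Some j then phi j else psi.
have psires x : psi (res x) = psi x.
  rewrite /res linformB // linform_sum // big1 ?subr0 // => i _.
  by rewrite psiP.2 psi0 ?mulr0.
exists n.+1, w', phi'; split.
- move=> i; rewrite /phi'; case: (unliftP ord0 i) => [j _|_]; first exact: phiP.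
  by split=> // x Jx; apply: psi0; apply: JT.
- move=> i j; rewrite /phi' /w'.
  case: (unliftP ord0 i) => [i' ->|->]; case: (unliftP ord0 j) => [j' ->|->] /=.
  + by rewrite dual (inj_eq lift_inj).
  + by rewrite phires.
  + by rewrite psi0.
  + by rewrite psi1.
- move=> i S Ss Sb; rewrite /w'; case: (unliftP ord0 i) => [j _|_].
    exact: spanres.
  rewrite /res; apply: subspaceB => //; first by apply: Sb; rewrite inE eqxx.
  by apply: subspace_sum => // j _; case: (Ss) => _ _; apply; apply: spanres.
- move=> x xs; rewrite big_ord_recl /w' /phi' unlift_none.
  have -> : \sum_(i < n) algMap B ((if unlift ord0 (lift ord0 i) is Some j then phi j else psi) x) *
      (if unlift ord0 (lift ord0 i) is Some j then w j else res b) =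
      \sum_(i < n) algMap B (phi i x) * w i.
    by apply: eq_bigr => i _; rewrite liftK.
  rewrite /= [X in x - X]addrC opprD addrA -/(res x); move: xs; rewrite inE => /predU1P [->|xs].
    by rewrite -psires psi1 rmorph1 mul1r subrr; case: Js.
  have Jx : J (res x) by apply: expand.
  by rewrite -psires psi0 ?rmorph0 ?mul0r ?subr0 //; apply: JT.
Qed.

End LinearForms.

(** * Tensor products over a field *)

Section TensorHom.
Variables (k : comPzRingType) (A B : algOver k).

Lemma tpure0l (b : B) : tpure (0 : A) b = 0.
Proof. exact: (balanced0l b (tpure_balanced A B)). Qed.

Lemma tpureDl (a a' : A) (b : B) : tpure (a + a') b = tpure a b + tpure a' b.
Proof. by case: (tpure_balanced A B). Qed.

Lemma tpureDr (a : A) (b b' : B) : tpure a (b + b') = tpure a b + tpure a b'.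
Proof. by case: (tpure_balanced A B). Qed.

Lemma tpureZ c (a : A) (b : B) : tpure (algMap A c * a) b = tpure a (algMap B c * b).
Proof. by case: (tpure_balanced A B). Qed.

Lemma tpure0r (a : A) : tpure a (0 : B) = 0.
Proof. by apply: (addrI (tpure a 0)); rewrite -tpureDr !addr0. Qed.

Lemma tpureNr (a : A) (b : B) : tpure a (- b) = - tpure a b.
Proof. by apply: (addrI (tpure a b)); rewrite -tpureDr !subrr tpure0r. Qed.

Lemma tpureNl (a : A) (b : B) : tpure (- a) b = - tpure a b.
Proof. exact: (balancedNl a b (tpure_balanced A B)). Qed.

Lemma tpure_suml (I : Type) (r : seq I) (P : pred I) (f : I -> A) (b : B) :
  tpure (\sum_(i <- r | P i) f i) b = \sum_(i <- r | P i) tpure (f i) b.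
Proof.
by apply: (big_morph (fun x => tpure x b)) => [x y|]; [exact: tpureDl|exact: tpure0l].
Qed.

Lemma tpure_sumr (I : Type) (r : seq I) (P : pred I) (a : A) (f : I -> B) :
  tpure a (\sum_(i <- r | P i) f i) = \sum_(i <- r | P i) tpure a (f i).
Proof.
by apply: (big_morph (tpure a)) => [x y|]; [exact: tpureDr|exact: tpure0r].
Qed.

Lemma tpure_lr (a : A) (b : B) : tpure a b = tinl B a * tinr A b.
Proof. by rewrite tpureM mulr1 mul1r. Qed.

Lemma tinl_algMap c : tinl B (algMap A c) = tinr A (algMap B c).
Proof. by rewrite /tinl /tinr -[algMap A c]mulr1 tpureZ mulr1. Qed.

Lemma tens_additive_ext (M : zmodType) (f g : tens A B -> M) :
  f 0 = 0 -> g 0 = 0 -> {morph f : x y / x + y} -> {morph g : x y / x + y} ->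
  (forall a b, f (tpure a b) = g (tpure a b)) -> f =1 g.
Proof.
by move=> f0 g0 fD gD fg; elim/tens_ind => [|a b x IH]; rewrite ?f0 ?g0 // fD gD IH fg.
Qed.

Lemma tens_rmorph_ext (C : comPzRingType) (f g : {rmorphism tens A B -> C}) :
  (forall a, f (tinl B a) = g (tinl B a)) -> (forall b, f (tinr A b) = g (tinr A b)) ->
  f =1 g.
Proof.
move=> hl hr; apply: tens_additive_ext; rewrite ?rmorph0 //; try exact: rmorphD.
by move=> a b; rewrite tpure_lr !rmorphM /= hl hr.
Qed.

Lemma tens_der_ext (C : comPzRingType) (f : {rmorphism tens A B -> C})
    (dT : derivation (tens A B)) (dC : derivation C) :
  (forall a, f (dT (tinl B a)) = dC (f (tinl B a))) ->
  (forall b, f (dT (tinr A b)) = dC (f (tinr A b))) ->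
  forall x, f (dT x) = dC (f x).
Proof.
move=> hl hr; apply: tens_additive_ext; rewrite ?(der_0, rmorph0) //.
- by move=> x y; rewrite derD rmorphD.
- by move=> x y; rewrite rmorphD derD.
by move=> a b; rewrite tpure_lr derM rmorphD !rmorphM derM /= hl hr.
Qed.

Variables (C : comPzRingType) (f : {rmorphism A -> C}) (g : {rmorphism B -> C}).
Hypothesis fg : forall c, f (algMap A c) = g (algMap B c).

Definition tpairing (x : tens A B) : C := tlift (fun a b => f a * g b) x.

Fact tpairing_balanced : balanced (fun a b => f a * g b).
Proof.
split=> [a a' b|a b b'|c a b]; rewrite ?rmorphD ?mulrDl ?mulrDr //.
by rewrite !rmorphM /= fg [g _ * _]mulrC mulrAC -mulrA [g b * _]mulrC.
Qed.

Fact tpairing_exists :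
  {h : {rmorphism tens A B -> C} | forall a b, h (tpure a b) = f a * g b}.
Proof.
have pureE a b : tpairing (tpure a b) = f a * g b.
  exact: (tlift_pure tpairing_balanced).
have p0 : tpairing 0 = 0 := tlift0 tpairing_balanced.
have pD : {morph tpairing : x y / x + y} := tliftD tpairing_balanced.
have zm : zmod_morphism tpairing.
  by move=> x y; apply/eqP; rewrite eq_sym subr_eq -pD subrK.
have mm : monoid_morphism tpairing.
  split=> [|x y]; first by rewrite -[1]/(tpure 1 1) pureE !rmorph1 mulr1.
  elim/tens_ind: x y => [|a b x IHx] y; first by rewrite mul0r p0 mul0r.
  rewrite mulrDl !pD mulrDl IHx; congr (_ + _).
  elim/tens_ind: y => [|a' b' y IHy]; first by rewrite mulr0 p0 mulr0.
  by rewrite mulrDr !pD mulrDr IHy tpureM !pureE !rmorphM mulrACA.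
pose h1 := GRing.isZmodMorphism.Build _ _ _ zm.
pose h2 := GRing.isMonoidMorphism.Build _ _ _ mm.
pose h : {rmorphism tens A B -> C} := HB.pack tpairing h1 h2.
by exists h.
Qed.

Definition tcopair : {rmorphism tens A B -> C} := sval tpairing_exists.

Lemma tcopair_pure a b : tcopair (tpure a b) = f a * g b.
Proof. exact: (svalP tpairing_exists). Qed.

Lemma tcopair_inl a : tcopair (tinl B a) = f a.
Proof. by rewrite tcopair_pure rmorph1 mulr1. Qed.

Lemma tcopair_inr b : tcopair (tinr A b) = g b.
Proof. by rewrite tcopair_pure rmorph1 mul1r. Qed.

End TensorHom.

Section TensorSlices.
Variables (k : fieldType) (A B : algOver k).
Implicit Types (J : B -> Prop) (phi : B -> k).

(** For a linear form this is the contraction $\mathrm{id}\otimes\varphi : A\otimes B\to A$;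
    [lslice] contracts the left factor instead. *)
Definition rslice phi (x : tens A B) : A := tlift (fun a b => algMap A (phi b) * a) x.
Definition lslice (psi : A -> k) (x : tens A B) : B :=
  tlift (fun a b => algMap B (psi a) * b) x.

Section Right.
Variable phi : B -> k.
Hypothesis phiP : linform phi.

Fact rslice_balanced : balanced (fun (a : A) (b : B) => algMap A (phi b) * a).
Proof.
split=> [a a' b|a b b'|c a b]; first by rewrite mulrDr.
  by rewrite phiP.1 rmorphD mulrDl.
by rewrite phiP.2 rmorphM mulrA [_ * algMap A c]mulrC.
Qed.

Lemma rslice_pure a b : rslice phi (tpure a b) = algMap A (phi b) * a.
Proof. exact: (tlift_pure rslice_balanced). Qed.

Lemma rslice0 : rslice phi 0 = 0.
Proof. exact: (tlift0 rslice_balanced). Qed.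

Lemma rsliceD : {morph rslice phi : x y / x + y}.
Proof. exact: (tliftD rslice_balanced). Qed.

Lemma rslice_sum (I : Type) (r : seq I) (P : pred I) (f : I -> tens A B) :
  rslice phi (\sum_(i <- r | P i) f i) = \sum_(i <- r | P i) rslice phi (f i).
Proof. exact: (big_morph _ rsliceD rslice0). Qed.

Lemma rsliceM a x : rslice phi (tinl B a * x) = a * rslice phi x.
Proof.
elim/tens_ind: x => [|a' b x IH]; first by rewrite mulr0 rslice0 mulr0.
by rewrite mulrDr !rsliceD IH mulrDr tpureM mul1r !rslice_pure mulrCA.
Qed.

End Right.

Section Left.
Variable psi : A -> k.
Hypothesis psiP : linform psi.

Fact lslice_balanced : balanced (fun (a : A) (b : B) => algMap B (psi a) * b).
Proof.
split=> [a a' b|a b b'|c a b]; first by rewrite psiP.1 rmorphD mulrDl.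
  by rewrite mulrDr.
by rewrite psiP.2 rmorphM mulrCA mulrA.
Qed.

Lemma lslice_pure a b : lslice psi (tpure a b) = algMap B (psi a) * b.
Proof. exact: (tlift_pure lslice_balanced). Qed.

Lemma lslice0 : lslice psi 0 = 0.
Proof. exact: (tlift0 lslice_balanced). Qed.

Lemma lsliceD : {morph lslice psi : x y / x + y}.
Proof. exact: (tliftD lslice_balanced). Qed.

Lemma lslice_sum (I : Type) (r : seq I) (P : pred I) (f : I -> tens A B) :
  lslice psi (\sum_(i <- r | P i) f i) = \sum_(i <- r | P i) lslice psi (f i).
Proof. exact: (big_morph _ lsliceD lslice0). Qed.

End Left.

(** The image of $A\otimes J$ in $A\otimes B$. *)
Definition tsub J (x : tens A B) : Prop := exists s : seq (A * B),
  (forall p, p \in s -> J p.2) /\ x = \sum_(p <- s) tpure p.1 p.2.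

Lemma tsub_pure J a b : J b -> tsub J (tpure a b).
Proof.
by move=> Jb; exists [:: (a, b)]; rewrite big_seq1; split=> // p; rewrite inE => /eqP->.
Qed.

Lemma tsub0 J : tsub J 0.
Proof. by exists [::]; rewrite big_nil. Qed.

Lemma tsubD J x y : tsub J x -> tsub J y -> tsub J (x + y).
Proof.
move=> [s [sJ ->]] [t [tJ ->]]; exists (s ++ t); rewrite big_cat; split=> // p.
by rewrite mem_cat => /orP [/sJ|/tJ].
Qed.

Lemma tsub_ind J (N : tens A B -> Prop) : N 0 ->
  (forall x y, N x -> N y -> N (x + y)) -> (forall a b, J b -> N (tpure a b)) ->
  forall x, tsub J x -> N x.
Proof.
move=> N0 ND NJ x [s [sJ ->]]; rewrite big_seq.
by elim/big_ind: _ => // p ps; apply: NJ; apply: sJ.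
Qed.

Lemma tsubM J a x : tsub J x -> tsub J (tinl B a * x).
Proof.
move: x; apply: tsub_ind => [|x y|a' b Jb]; first by rewrite mulr0; apply: tsub0.
  by rewrite mulrDr; apply: tsubD.
by rewrite tpureM mul1r; apply: tsub_pure.
Qed.

Lemma tsub_sum J (I : Type) (r : seq I) (P : pred I) (f : I -> tens A B) :
  (forall i, P i -> tsub J (f i)) -> tsub J (\sum_(i <- r | P i) f i).
Proof.
by move=> h; elim/big_ind: _ => //; [apply: tsub0|move=> *; apply: tsubD].
Qed.

Lemma tsub_set0 x : tsub (fun b => b = 0) x -> x = 0.
Proof.
by move: x; apply: tsub_ind => // [x y -> ->|a b ->]; rewrite ?addr0 ?tpure0r.
Qed.

Lemma tsub_rslice J phi x : linform phi -> (forall b, J b -> phi b = 0) ->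
  tsub J x -> rslice phi x = 0.
Proof.
move=> phiP phiJ; move: x; apply: tsub_ind => [|x y x0 y0|a b Jb]; first exact: rslice0.
  by rewrite rsliceD // x0 y0 addr0.
by rewrite rslice_pure // phiJ // rmorph0 mul0r.
Qed.

(** Expanding the second components by [dual_basis] makes the coefficients slices. The list s is
    fixed before t so that one family w serves several tensors at once. *)
Lemma tens_decomp J (s : seq (A * B)) : subspace J ->
  exists (n : nat) (w : 'I_n -> B) (phi : 'I_n -> B -> k),
  [/\ forall i, linform (phi i) /\ forall x, J x -> phi i x = 0,
      forall i j, phi i (w j) = (i == j)%:R,
      forall i S, subspace S -> (forall p, p \in s -> S p.2) -> S (w i) &
      forall t, {subset t <= s} -> let x := \sum_(p <- t) tpure p.1 p.2 in
        tsub J (x - \sum_i tpure (rslice (phi i) x) (w i))].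
Proof.
move=> Js; have [n [w [phi [phiP dual span expand]]]] := dual_basis (map snd s) Js.
exists n, w, phi; split=> // [i S Ss Sp|t ts x].
  by apply: span => // b /mapP [p ps ->]; apply: Sp.
have -> : x - \sum_i tpure (rslice (phi i) x) (w i) =
    \sum_(p <- t) tpure p.1 (p.2 - \sum_i algMap B (phi i p.2) * w i).
  under [RHS]eq_bigr => p _ do rewrite tpureDr tpureNr tpure_sumr.
  rewrite big_split /= sumrN exchange_big /=; congr (_ - _).
  apply: eq_bigr => i _; rewrite rslice_sum ?tpure_suml; last exact: (phiP i).1.
  by apply: eq_bigr => p _; rewrite rslice_pure ?tpureZ //; exact: (phiP i).1.
rewrite big_seq; apply: tsub_sum => p pt; apply: tsub_pure; apply: expand.
by apply: map_f; apply: ts.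
Qed.

Lemma tens_decomp1 J x : subspace J ->
  exists (n : nat) (w : 'I_n -> B) (phi : 'I_n -> B -> k),
  [/\ forall i, linform (phi i) /\ forall x, J x -> phi i x = 0,
      forall i j, phi i (w j) = (i == j)%:R &
      tsub J (x - \sum_i tpure (rslice (phi i) x) (w i))].
Proof.
move=> Js; have [n [w [phi [phiP dual _ expand]]]] := tens_decomp (repr x) Js.
by exists n, w, phi; split=> //; rewrite {1 2}(tens_sumE x); apply: expand.
Qed.

(** Modulo $A\otimes J$, a tensor is a sum whose coefficients are its own slices along forms killing
    J; when these vanish, nothing is left outside $A\otimes J$. *)
Lemma tsubP J x : subspace J ->
  (forall phi, linform phi -> (forall b, J b -> phi b = 0) -> rslice phi x = 0) ->
  tsub J x.
Proof.
move=> Js x0; have [n [w [phi [phiP _]]]] := tens_decomp1 x Js.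
rewrite big1 ?subr0 // => i _; have [? ?] := phiP i.
by rewrite x0 // tpure0l.
Qed.

Lemma tinr_inj : (1 : A) != 0 -> injective (@tinr k A B).
Proof.
move=> A1 b b' bb'; apply/eqP; rewrite -subr_eq0; apply: contraT => /eqP b0.
have [phi [phiP _ phi1]] := separation (subspace0 B) b0.
have : rslice phi (tinr A (b - b')) = 0 by rewrite raddfB /= bb' subrr rslice0.
by rewrite rslice_pure // phi1 rmorph1 mulr1 => /eqP; rewrite (negbTE A1).
Qed.

End TensorSlices.

Section TensorTranspose.
Variables (k : fieldType) (A B : algOver k).

Lemma tens_ldecomp (x : tens A B) :
  exists (n : nat) (u : 'I_n -> A) (psi : 'I_n -> A -> k),
  [/\ forall i, linform (psi i), forall i j, psi i (u j) = (i == j)%:R &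
      x = \sum_i tpure (u i) (lslice (psi i) x)].
Proof.
have [n [u [psi [psiP dual _ expand]]]] := dual_basis (map fst (repr x)) (subspace0 A).
exists n, u, psi; split=> // [i|]; first by case: (psiP i).
rewrite {1}(tens_sumE x).
transitivity (\sum_(p <- repr x) \sum_i tpure (u i) (algMap B (psi i p.1) * p.2)).
  apply: eq_big_seq => p px; under eq_bigr => i _ do rewrite -tpureZ.
  rewrite -tpure_suml; congr tpure; apply/eqP; rewrite -subr_eq0; apply/eqP.
  by apply: expand; apply: map_f.
rewrite exchange_big; apply: eq_bigr => i _; rewrite -tpure_sumr; congr tpure.
Qed.

End TensorTranspose.

(** * Differential submodules of a constant extension *)

Lemma der_sum (A : comPzRingType) (d : derivation A) (I : Type) (r : seq I)
    (P : pred I) (f : I -> A) :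
  d (\sum_(i <- r | P i) f i) = \sum_(i <- r | P i) d (f i).
Proof. exact: (big_morph d (derD d) (der_0 d)). Qed.

Section Constants.
Variables (F : fieldType) (d : derivation F).
Notation K := (constField d).
Notation resK := (resAlg (constIncl d)).
Variables (R : diffAlg d) (A : algOver K).
Notation T := (tens (resK R) A).
Notation inl := (@tinl K (resK R) A).
Notation inr := (@tinr K (resK R) A).
Notation dT := (der (RtensA R A)).

Lemma RtensA_der_pure (r : R) (a : A) :
  dT (@tpure K (resK R) A r a) = @tpure K (resK R) A (der R r) a.
Proof.
rewrite [LHS](@tens_der_pure K (der0 K) (resDiffAlg (@constInclP F d) R) (constDiffAlg A)).
by rewrite [X in _ + X](@tpure0r _ (resK R) A) addr0.
Qed.

Lemma RtensA_der_inl (r : R) : dT (inl r) = inl (der R r).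
Proof. exact: RtensA_der_pure. Qed.

Lemma RtensA_der_inr (a : A) : dT (inr a) = 0.
Proof. by rewrite [LHS]RtensA_der_pure der_1 (@tpure0l _ (resK R) A). Qed.

Lemma rslice_der (phi : A -> K) (x : T) : linform phi ->
  der R (rslice phi x) = rslice phi (dT x : T).
Proof.
move=> phiP; elim/tens_ind: x => [|a b x IH].
  by rewrite [dT 0](der_0 (der (RtensA R A))) !rslice0 // der_0.
rewrite rsliceD // derD IH [dT (_ + _)](derD (der (RtensA R A))) rsliceD //.
congr (_ + _); rewrite [dT (tpure a b)]RtensA_der_pure !rslice_pure // derM.
by rewrite /= derMap constInclP rmorph0 mul0r add0r.
Qed.

Hypothesis constR : constants_eq_K R.

(** Slicing commutes with the derivations, so the coefficients of x modulo $R\otimes J$, being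
    slices along forms that kill J, are constants of R. They lie in K and move to the right
    factor. *)
Lemma const_mod_tsub (J : A -> Prop) (x : T) : subspace J ->
  tsub J (dT x : T) -> exists a, tsub J (x - inr a).
Proof.
move=> Js dx; have [n [w [phi [phiP _ xE]]]] := tens_decomp1 x Js.
have cst i : exists c : K, rslice (phi i) x = algMap R (constIncl d c).
  have [phii phiJ] := phiP i.
  by apply/constR; rewrite rslice_der // (tsub_rslice phii phiJ dx).
have [c cE] := choice cst; exists (\sum_i algMap A (c i) * w i).
move: xE; congr (tsub J (_ - _)); rewrite [RHS](@tpure_sumr K (resK R) A).
apply: eq_bigr => i _; rewrite cE -[X in tpure X _]mulr1.
exact: (@tpureZ K (resK R) A).
Qed.

Lemma const_RtensA (x : T) : dT x = 0 -> exists a, x = inr a.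
Proof.
move=> dx; have [|a /tsub_set0 xa] := @const_mod_tsub (fun a => a = 0) x (subspace0 A).
  by rewrite dx; apply: tsub0.
by exists a; apply/eqP; rewrite -subr_eq0 xa.
Qed.

Hypothesis simpleR : simple_diff (der R).

(* Induction on the length of x: the coefficients of a fixed tensor factor
   occurring in N form a differential ideal, so that factor may be assumed to
   have coefficient 1, and then disappears from the derivative. *)
Lemma diff_submodule_tsub (N : T -> Prop) :
  N 0 -> (forall x y, N x -> N y -> N (x + y)) ->
  (forall r x, N x -> N (inl r * x)) -> (forall x, N x -> N (dT x)) ->
  forall x, N x -> tsub (fun a => N (inr a)) x.
Proof.
move=> N0 ND NM Nd; set J := fun a => N (inr a).
have NB x y : N x -> N y -> N (x - y).
  by move=> Nx Ny; apply: ND => //; have := NM (-1) _ Ny; rewrite rmorphN1 mulN1r.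
have Js : subspace J.
  split=> [|a b Ja Jb|c a Ja]; rewrite /J ?raddf0 //; first by rewrite raddfD; apply: ND.
  by rewrite rmorphM /= -(tinl_algMap (resK R) A); apply: NM.
have JN x : tsub J x -> N x.
  by apply: tsub_ind => // a b Jb; rewrite tpure_lr; apply: NM.
(* Coefficients and factors are indexed by all of [nat], so that dropping the last term leaves both
   functions unchanged. *)
pose comb n (f : nat -> R) (b : nat -> A) : T :=
  \sum_(i < n) @tpure K (resK R) A (f i) (b i).
suff main n f b : N (comb n f b) -> tsub J (comb n f b).
  move=> x; rewrite (tens_sumE x) (big_nth (0, 0)) big_mkord.
  exact: (main _ (fun i => (nth (0, 0) (repr x) i).1) (fun i => (nth (0, 0) (repr x) i).2)).
have combD m f1 f2 c : comb m f1 c + comb m f2 c = comb m (fun i => f1 i + f2 i) c.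
  by rewrite -big_split; apply: eq_bigr => i _; rewrite [RHS](@tpureDl K (resK R) A).
have combM m r f1 c : inl r * comb m f1 c = comb m (fun i => r * f1 i) c.
  rewrite mulr_sumr; apply: eq_bigr => i _.
  by rewrite (@tpureM K (resK R) A) mul1r.
have combd m f1 c : dT (comb m f1 c) = comb m (fun i => der R (f1 i)) c.
  rewrite [LHS]der_sum; apply: eq_bigr => i _; exact: RtensA_der_pure.
elim: n f b => [|n IH] f b; first by rewrite /comb big_ord0 => _; apply: tsub0.
have combS f1 r : comb n f1 b + @tpure K (resK R) A r (b n) =
    comb n.+1 (fun i => if i == n then r else f1 i) b.
  rewrite [RHS]big_ord_recr /= eqxx; congr (_ + _); apply: eq_bigr => i _.
  by rewrite ltn_eqF.
pose I r := exists f1, N (comb n f1 b + @tpure K (resK R) A r (b n)).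
have I0 : I 0.
  exists (fun=> 0); rewrite [tpure 0 _](@tpure0l K (resK R) A) addr0 /comb big1 // => i _.
  exact: (@tpure0l K (resK R) A).
have ID r s : I r -> I s -> I (r + s).
  move=> [f1 h1] [f2 h2]; exists (fun i => f1 i + f2 i).
  by rewrite -combD (@tpureDl K (resK R) A) addrACA; apply: ND.
have IM r s : I s -> I (r * s).
  move=> [f1 h1]; exists (fun i => r * f1 i); have := NM r _ h1.
  by rewrite mulrDr combM (@tpureM K (resK R) A) mul1r.
have Id r : I r -> I (der R r).
  move=> [f1 h1]; exists (fun i => der R (f1 i)); have := Nd _ h1.
  by rewrite [dT _](derD (der (RtensA R A))) combd RtensA_der_pure.
have combE : comb n.+1 f b = comb n f b + @tpure K (resK R) A (f n) (b n).
  exact: big_ord_recr.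
rewrite combE => Nx.
have [I_0|/(_ 1) [f1 Ny]] := simpleR I0 ID IM Id.
  have fn0 : f n = 0 by apply: I_0; exists f.
  move: Nx; rewrite fn0 [tpure 0 _](@tpure0l K (resK R) A) addr0; exact: IH.
set y := _ + _ in Ny.
have dy : tsub J (dT y : T).
  have := Nd _ Ny; rewrite [dT y](derD (der (RtensA R A))) combd RtensA_der_pure der_1.
  rewrite [tpure 0 _](@tpure0l K (resK R) A) addr0; exact: IH.
have [a ya] := const_mod_tsub Js dy.
have Ja : J a by rewrite /J -[inr a](subKr y); apply: NB => //; apply: JN.
have Jy : tsub J y by rewrite -[y](subrK (inr a)); apply: tsubD => //; apply: tsub_pure.
set x := comb n f b + _ in Nx *.
(* As y has last coefficient 1, subtracting [f n] times y cancels the last term of x, and the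
   induction hypothesis applies to the difference. *)
rewrite -[x](subrK (inl (f n) * y)); apply: tsubD; last exact: tsubM.
have xE : x - inl (f n) * y = comb n (fun i => f i + (- f n * f1 i)) b.
  rewrite /x /y mulrDr combM (@tpureM K (resK R) A) mul1r mulr1 opprD addrACA subrr addr0.
  rewrite -combD; congr (_ + _); rewrite -sumrN; apply: eq_bigr => i _.
  by rewrite mulNr [RHS](@tpureNl K (resK R) A).
have := NB _ _ Nx (NM (f n) _ Ny); rewrite xE; exact: IH.
Qed.

End Constants.

(** * Picard-Vessiot rings from constants of the tensor square *)

Section Span.
Variables (k : fieldType) (A : algOver k).

Definition lspan (s : seq A) (x : A) : Prop :=
  forall S, subspace S -> (forall y, y \in s -> S y) -> S x.

Lemma lspan_subspace s : subspace (lspan s).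
Proof.
split=> [S [S0 _ _] _|x y hx hy S Ss Sg|c x hx S Ss Sg] //.
  by case: (Ss) => _ h _; apply: h; [apply: hx|apply: hy].
by case: (Ss) => _ _; apply; apply: hx.
Qed.

Lemma mem_lspan s x : x \in s -> lspan s x.
Proof. by move=> xs S _; apply. Qed.

Lemma sub_lspan (s t : seq A) x :
  (forall y, y \in s -> lspan t y) -> lspan s x -> lspan t x.
Proof. by move=> st; apply => //; apply: lspan_subspace. Qed.

Lemma lspan_sub (s t : seq A) x : {subset s <= t} -> lspan s x -> lspan t x.
Proof. by move=> st; apply: sub_lspan => y /st; apply: mem_lspan. Qed.

End Span.

Lemma natr_inj_pchar0 (F : fieldType) : [pchar F] =i pred0 ->
  injective (fun n : nat => n%:R : F).
Proof.
move=> charF; have half m n : (m%:R : F) = n%:R -> (m <= n)%N.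
  move=> mn; rewrite leqNgt; apply/negP => nm.
  have := (pcharf0P F).1 charF (m - n)%N; rewrite natrB 1?ltnW // mn subrr eqxx.
  by rewrite subn_eq0 leqNgt nm.
by move=> m n mn; apply/eqP; rewrite eqn_leq !half.
Qed.

Section Criterion.
Variables (F : fieldType) (d : derivation F).
Notation K := (constField d).
Notation resK := (resAlg (constIncl d)).
Variables (R : diffAlg d) (B : algOver K).
Notation T := (tensDiffAlg R R).
Notation RB := (tens (resK R) B).
Notation inlB := (@tinl K (resK R) B).
Notation inrB := (@tinr K (resK R) B).
Notation dB := (der (RtensA R B)).
Notation inlT := (@tinl F R R).
Notation inrT := (@tinr F R R).

Lemma tens_der_inl (X Y : diffAlg d) (x : X) :
  der (tensDiffAlg X Y) (@tinl F X Y x) = @tinl F X Y (der X x).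
Proof. by rewrite [LHS]tens_der_pure der_1 tpure0r addr0. Qed.

Lemma tens_der_inr (X Y : diffAlg d) (y : Y) :
  der (tensDiffAlg X Y) (@tinr F X Y y) = @tinr F X Y (der Y y).
Proof. by rewrite [LHS]tens_der_pure der_1 tpure0l add0r. Qed.

Variable psi : {rmorphism RB -> tens R R}.
Hypotheses (psi_inl : forall r, psi (inlB r) = inlT r)
  (psi_const : forall b, der T (psi (inrB b)) = 0).

Lemma psi_der x : psi (dB x) = der T (psi x).
Proof.
apply: (@tens_der_ext K (resK R) B (tens R R) psi (der (RtensA R B)) (der T)) => [r|b].
  by rewrite RtensA_der_inl !psi_inl [RHS]tens_der_inl.
by rewrite RtensA_der_inr psi_const rmorph0.
Qed.

Definition der_stable (s : seq R) : Prop := forall y, y \in s -> lspan s (der R y).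

Lemma der_stable_cat s t : der_stable s -> der_stable t -> der_stable (s ++ t).
Proof.
move=> hs ht y; rewrite mem_cat => /orP [/hs|/ht]; apply: lspan_sub => x xs.
  by rewrite mem_cat xs.
by rewrite mem_cat xs orbT.
Qed.

Lemma der_stable_lspan s x : der_stable s -> lspan s x -> lspan s (der R x).
Proof.
move=> hs sx; have [s0 sD sZ] := lspan_subspace s.
suff [] : lspan s x /\ lspan s (der R x) by [].
apply: (sx (fun x => lspan s x /\ lspan s (der R x))).
  split=> [|a b [ha ha'] [hb hb']|c a [ha ha']].
  - by rewrite der_0; split.
  - by rewrite derD; split; apply: sD.
  by rewrite derM derMap; split; [apply: sZ|apply: sD; apply: sZ].
by move=> y ys; split; [apply: mem_lspan|apply: hs].
Qed.

(* Writing c as the sum of u_i (x) y_i with the u_i linearly independent,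
   applying to d(c) = 0 the forms dual to the u_i expresses each d(y_i) in
   terms of the y_j. *)
Lemma const_der_stable (c : tens R R) : der T c = 0 ->
  exists s, der_stable s /\
    forall la, linform la -> (forall y, y \in s -> la y = 0) -> rslice la c = 0.
Proof.
move=> dc; have [n [u [la [laP dual cE]]]] := tens_ldecomp c.
pose y i := lslice (la i) c.
exists [seq y i | i <- enum 'I_n]; split; last first.
  move=> mu muP mu0; rewrite cE rslice_sum // big1 // => i _.
  by rewrite rslice_pure // mu0 ?rmorph0 ?mul0r // (map_f y) ?mem_enum.
move=> _ /mapP [i _ ->].
have dy : der R (y i) = - \sum_j algMap R (la i (der R (u j))) * y j.
  have : lslice (la i) (der T c) = \sum_j (algMap R (la i (der R (u j))) * y j +
      algMap R (i == j)%:R * der R (y j)).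
    rewrite {1}cE der_sum lslice_sum //; apply: eq_bigr => j _.
    by rewrite [der _ _]tens_der_pure lsliceD // !lslice_pure // dual.
  rewrite dc lslice0 // big_split /= addrC (bigD1 i) //= eqxx rmorph1 mul1r.
  rewrite [X in _ + X + _]big1 ?addr0.
    by move/esym/eqP; rewrite addr_eq0 => /eqP.
  by move=> j ji; rewrite eq_sym (negbTE ji) rmorph0 mul0r.
rewrite dy; have Ss := lspan_subspace [seq y i | i <- enum 'I_n].
apply: (subspaceN Ss); apply: (subspace_sum _ Ss) => j _; case: Ss => _ _; apply.
by apply: mem_lspan; rewrite (map_f y) ?mem_enum.
Qed.

Hypothesis R1 : (1 : R) != 0.
Hypothesis psi_surj : forall x, exists t, psi t = x.

(** The tensor $1\otimes r$ is an R-linear combination of finitely many constants, each of which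
    provides a stable list. If r were outside the span of their concatenation, a form killing this
    span with value 1 at r would slice $1\otimes r$ both to 0 and to 1. *)
Lemma der_stable_exists (r : R) : exists s, der_stable s /\ lspan s r.
Proof.
have [t tE] := psi_surj (inrT r).
have [s [ss sP]] : exists s, der_stable s /\
    forall la, linform la -> (forall y, y \in s -> la y = 0) -> rslice la (psi t) = 0.
  elim/tens_ind: t {tE} => [|a b t [s [ss IH]]].
    by exists [::]; split=> // la laP _; rewrite rmorph0 rslice0.
  have [s' [ss' IH']] := const_der_stable (psi_const b).
  exists (s' ++ s); split; first exact: der_stable_cat.
  move=> la laP la0; rewrite rmorphD rsliceD // IH ?addr0 => [|//|y ys].
    rewrite tpure_lr rmorphM /= psi_inl rsliceM // IH' ?mulr0 // => y ys.
    by apply: la0; rewrite mem_cat ys.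
  by apply: la0; rewrite mem_cat ys orbT.
exists s; split=> //; apply: contrapT => nr.
have [la [laP la0 la1]] := separation (lspan_subspace s) nr.
have := sP la laP (fun y ys => la0 y (mem_lspan ys)).
rewrite tE rslice_pure // la1 rmorph1 mulr1 => /eqP; by rewrite (negbTE R1).
Qed.

Lemma der_stable_seq (rs : seq R) :
  exists s, der_stable s /\ forall r, r \in rs -> lspan s r.
Proof.
elim: rs => [|r rs [s [ss IH]]]; first by exists [::].
have [s' [ss' IH']] := der_stable_exists r.
exists (s' ++ s); split; first exact: der_stable_cat.
move=> x; rewrite inE => /predU1P [->|/IH].
  by apply: lspan_sub IH' => y ys; rewrite mem_cat ys.
by apply: lspan_sub => y ys; rewrite mem_cat ys orbT.
Qed.

Hypothesis psi_inj : injective psi.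
Hypotheses (simpleR : simple_diff (der R)) (constR : constants_eq_K R).
Hypotheses (charF : [pchar F] =i pred0) (ftR : finite_type R).

(* On a finite-dimensional d-stable subspace with basis y_i, the matrices Z and S
   express 1 (x) y_i through the constants psi (1 (x) w_j) and conversely; they
   are mutually inverse, hence square (compare traces), and Z is a fundamental
   solution matrix of the equation satisfied by the y_i. *)
Lemma picard_vessiot_of_const_tens : picard_vessiot R.
Proof.
have [gens gensP] := ftR.
(* Including 1 forces the basis y to be non-empty, as the size of a fundamental matrix must be
   positive. *)
have [s [ss sgen]] := der_stable_seq (1 :: gens).
have [m [y [la [laP dual yspan yE]]]] := dual_basis s (subspace0 R).
have {laP} laP i : linform (la i) := (laP i).1.
have spanE x : lspan s x -> x = \sum_i algMap R (la i x) * y i.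
  move=> sx; apply: (sx (fun x => x = \sum_i algMap R (la i x) * y i)).
    split=> [|a b aE bE|c a aE].
    - by rewrite big1 // => i _; rewrite linform0 // rmorph0 mul0r.
    - rewrite {1}aE {1}bE -big_split; apply: eq_bigr => i _.
      by rewrite (laP i).1 rmorphD mulrDl.
    rewrite {1}aE mulr_sumr; apply: eq_bigr => i _.
    by rewrite (laP i).2 rmorphM mulrA.
  by move=> b /yE /eqP; rewrite subr_eq0 => /eqP.
have sy i : lspan s (y i) by move=> S Ss Sg; apply: yspan.
pose a i k := la k (der R (y i)).
have dy i : der R (y i) = \sum_k algMap R (a i k) * y k.
  by apply: spanE; apply: der_stable_lspan.
(* N is the preimage under [psi] of $R\otimes_F V$, where V is the span of the [y i]. It is d-stable
   because V is, so the key fact writes each [t i], the preimage of $1\otimes y_i$, through elements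
   b of B with $1\otimes b$ in N. *)
pose N (x : RB) := exists f : 'I_m -> R, psi x = \sum_i tpure (f i) (y i).
have N0 : N 0 by exists (fun=> 0); rewrite rmorph0 big1 // => i _; rewrite tpure0l.
have ND x x' : N x -> N x' -> N (x + x').
  move=> [f fE] [f' f'E]; exists (fun i => f i + f' i).
  by rewrite rmorphD fE f'E -big_split; apply: eq_bigr => i _; rewrite tpureDl.
have NM r x : N x -> N (inlB r * x).
  move=> [f fE]; exists (fun i => r * f i).
  rewrite rmorphM fE psi_inl mulr_sumr; apply: eq_bigr => i _.
  by rewrite tpureM mul1r.
have Nd x : N x -> N (dB x).
  move=> [f fE]; exists (fun k => der R (f k) + \sum_i algMap R (a i k) * f i).
  rewrite psi_der fE der_sum.
  under eq_bigr => i _ do rewrite [der _ _]tens_der_pure dy tpure_sumr.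
  under [RHS]eq_bigr => i _ do rewrite tpureDl tpure_suml.
  rewrite !big_split /=; congr (_ + _); rewrite exchange_big /=.
  by apply: eq_bigr => i _; apply: eq_bigr => k _; rewrite tpureZ.
have [t tE] := choice (fun i => psi_surj (inrT (y i))).
have Nt i : N (t i).
  exists (fun j => (j == i)%:R); rewrite tE (bigD1 i) //= eqxx big1 ?addr0 // => j ji.
  by rewrite (negbTE ji) tpure0l.
have tJ i := diff_submodule_tsub constR simpleR N0 ND NM Nd (Nt i).
have [ps psE] := choice tJ.
have Js : subspace (fun b => N (inrB b)).
  split=> [|b b' hb hb'|c b hb]; rewrite ?raddf0 ?raddfD //; first exact: ND.
  by rewrite rmorphM /= -(tinl_algMap (resK R) B); apply: NM.
(* The representations of all the [t i] are concatenated in order to expand them in a single family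
   w, whose coefficients form Z. *)
have [n [w [phi [phiP dualw wspan tw]]]] :=
  tens_decomp (flatten [seq ps i | i <- enum 'I_m]) (subspace0 B).
have {phiP} phiP i : linform (phi i) := (phiP i).1.
have Nw j : N (inrB (w j)).
  apply: (wspan j (fun b => N (inrB b)) Js) => p /flattenP [q /mapP [i _ ->]].
  exact: (psE i).1.
pose Z := \matrix_(i < m, j < n) rslice (phi j) (t i).
have tZ i : t i = \sum_j inlB (Z i j) * inrB (w j).
  have sub : {subset ps i <= flatten [seq ps i | i <- enum 'I_m]}.
    move=> p pi; apply/flattenP; exists (ps i) => //.
    by apply: map_f; rewrite mem_enum.
  have := tw _ sub; rewrite /= -(psE i).2 => /tsub_set0 /eqP.
  rewrite subr_eq0 => /eqP {1}->; apply: eq_bigr => j _.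
  by rewrite mxE -tpure_lr.
have [sw swE] := choice Nw.
pose S := \matrix_(j < n, i < m) sw j i.
have ZS : Z *m S = 1%:M.
  apply/matrixP => i k; rewrite !mxE.
  have := congr1 (rslice (la k)) (congr1 psi (tZ i)).
  rewrite tE rslice_pure // mulr1 dual rmorph_nat [(k == i)%B]eq_sym => ->.
  rewrite rmorph_sum rslice_sum //; apply: eq_bigr => j _.
  rewrite rmorphM /= psi_inl rsliceM // swE rslice_sum //; congr (_ * _).
  rewrite (bigD1 k) //= rslice_pure // dual eqxx rmorph1 mul1r mxE.
  rewrite big1 ?addr0 // => l lk.
  by rewrite rslice_pure // dual eq_sym (negbTE lk) rmorph0 mul0r.
have SZ : S *m Z = 1%:M.
  apply/matrixP => j k; rewrite !mxE.
  have E : inrB (w j) = \sum_i inlB (S j i) * t i.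
    apply: psi_inj; rewrite swE rmorph_sum; apply: eq_bigr => i _.
    by rewrite rmorphM /= psi_inl tE mxE tpure_lr.
  have := congr1 (rslice (phi k)) E.
  rewrite rslice_pure // mulr1 dualw rmorph_nat [(k == j)%B]eq_sym => ->.
  rewrite rslice_sum //; apply: eq_bigr => i _.
  by rewrite rsliceM // !mxE.
have mn : m = n.
  have : algMap R m%:R = algMap R n%:R.
    by rewrite !rmorph_nat -[LHS]mxtrace1 -[RHS]mxtrace1 -ZS -SZ mxtrace_mulC.
  have algI (c e : F) : algMap R c = algMap R e -> c = e.
    move=> ce; apply/eqP; rewrite -subr_eq0; apply: contraT => nz.
    have := rmorph1 (algMap R).
    by rewrite -(mulVf nz) rmorphM rmorphB ce subrr mulr0 => /esym/eqP; rewrite (negbTE R1).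
  by move/algI; apply: natr_inj_pchar0.
subst n.
have dZ : map_mx (der R) Z = map_mx (algMap R) (\matrix_(i, k) a i k) *m Z.
  apply/matrixP => i j; rewrite !mxE rslice_der //.
  have -> : dB (t i) = \sum_k inlB (algMap R (a i k)) * t k.
    apply: psi_inj; rewrite psi_der tE rmorph_sum [LHS]tens_der_inr dy raddf_sum.
    apply: eq_bigr => k _; rewrite [RHS]rmorphM /= psi_inl tE -tpure_lr.
    by rewrite -[X in tpure X (y k)]mulr1 tpureZ.
  by rewrite rslice_sum //; apply: eq_bigr => k _; rewrite rsliceM // !mxE.
split=> //; exists m, Z, S, (\det S); split; first split=> //.
- rewrite lt0n; apply/negP => /eqP m0; case/negP: R1; apply/eqP.
  have /spanE -> := sgen 1 (mem_head _ _).
  by move: (y) (la); rewrite m0 => y' la'; rewrite big_ord0.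
- by exists (\matrix_(i, k) a i k); rewrite dZ -mulmxA ZS mulmx1.
- by rewrite -det_mulmx SZ det1.
move=> Q QF QD QM Qg; apply: gensP => // x xg.
have Q0 : Q 0 by rewrite -(rmorph0 (algMap R)).
have /spanE -> : lspan s x by apply: sgen; rewrite inE xg orbT.
elim/big_ind: _ => // i _; apply: (QM) => //.
(* Multiplication $R\otimes_F R\to R$ is differential, so it sends the constants [psi (inrB (w j))]
   into $C_R=K$. Applied to the expansion of $1\otimes y_i$, it expresses [y i] as a K-linear
   combination of entries of Z. *)
pose mul := @tcopair F R R R idfun idfun (fun=> erefl).
have mul_der x' : mul (der T x') = der R (mul x').
  apply: (@tens_der_ext F R R R mul (der T) (der R)) => r.
    by rewrite tens_der_inl !tcopair_inl.
  by rewrite tens_der_inr !tcopair_inr.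
have <- : mul (inrT (y i)) = y i by rewrite tcopair_inr.
rewrite -tE tZ !rmorph_sum; elim/big_ind: _ => // j _.
rewrite !rmorphM /= psi_inl tcopair_inl; apply: (QM); first by apply: Qg; left; exists i, j.
have /constR [c ->] : der R (mul (psi (inrB (w j)))) = 0 by rewrite -mul_der psi_const rmorph0.
exact: QF.
Qed.

End Criterion.

(** * Points of the group and base change to constant algebras *)

Lemma inj_surj_bij (X Y : Type) (f : X -> Y) :
  injective f -> (forall y, exists x, f x = y) -> bijective f.
Proof.
move=> f_inj /choice [g gK]; exists g => // x.
by apply: f_inj; rewrite gK.
Qed.

Section GroupPoints.
Variables (k : comPzRingType) (G : linAlgGroup k).
Implicit Types A B : algOver k.

Lemma gmulgV A (g : algHom (coordRing G) A) : gmul G g (ginv g) = gone G A.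
Proof.
rewrite -[LHS]gmul1 -{1}(gmulV (ginv g)) -gmulA [gmul G (ginv g) (gmul _ _ _)]gmulA.
by rewrite gmulV gmul1 gmulV.
Qed.

Lemma gone_idem A (g : algHom (coordRing G) A) : gmul G g g = g -> g = gone G A.
Proof. by move=> gg; rewrite -[LHS]gmul1 -(gmulV g) -gmulA gg. Qed.

Lemma gone_nat A B (f : algHom A B) : algComp f (gone G A) = gone G B.
Proof. by apply: gone_idem; rewrite -gmul_nat gmul1. Qed.

End GroupPoints.

Section BaseChange.
Variables (F : fieldType) (d : derivation F).
Notation K := (constField d).
Notation resK := (resAlg (constIncl d)).
Notation resHomK := (resHom (constIncl d)).
Variable R : diffAlg d.

(* R (x)_K A, with F acting through R. *)
Definition RA (A : algOver K) : algOver F :=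
  @AlgOver F (tens (resK R) A) (@tinl K (resK R) A \o algMap R).

Definition RAinl A : algHom R (RA A) :=
  @AlgHom F R (RA A) (@tinl K (resK R) A : {rmorphism _ -> tens (resK R) A}) (fun=> erefl).

Fact RAinr_subproof (A : algOver K) (c : K) :
  @tinr K (resK R) A (algMap A c) = algMap (resK (RA A)) c.
Proof. by rewrite -(tinl_algMap (resK R)). Qed.

Definition RAinr A : algHom A (resK (RA A)) :=
  @AlgHom K A (resK (RA A)) (@tinr K (resK R) A : {rmorphism _ -> tens (resK R) A})
    (@RAinr_subproof A).

Fact RAmap_subproof (A A' : algOver K) (f : algHom A A') (c : F) :
  RtensMap R f (algMap (RA A) c) = algMap (RA A') c.
Proof. by rewrite /= tmap_pure rmorph1. Qed.

Definition RAmap A A' (f : algHom A A') : algHom (RA A) (RA A') :=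
  @AlgHom F (RA A) (RA A') (RtensMap R f) (RAmap_subproof f).

Lemma RAmap_inl A A' (f : algHom A A') r : RAmap f (RAinl A r) = RAinl A' r.
Proof. by rewrite /= tmap_pure rmorph1. Qed.

Lemma RAmap_inr A A' (f : algHom A A') a : RAmap f (RAinr A a) = RAinr A' (f a).
Proof. by rewrite /= tmap_pure. Qed.

Lemma RAmap_der A A' (f : algHom A A') x :
  RAmap f (der (RtensA R A) x) = der (RtensA R A') (RAmap f x).
Proof.
apply: (@tens_der_ext K (resK R) A _ (RAmap f) (der (RtensA R A)) (der (RtensA R A'))).
  move=> r; rewrite RtensA_der_inl [RAmap f _](RAmap_inl f) [RAmap f _](RAmap_inl f).
  by rewrite [RHS]RtensA_der_inl.
move=> b; rewrite RtensA_der_inr rmorph0 [RAmap f _](RAmap_inr f).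
by rewrite [RHS]RtensA_der_inr.
Qed.

Lemma RA_extend A (C : algOver F) (f : algHom R C) (g : algHom A (resK C)) :
  exists h : algHom (RA A) C, (forall r, h (RAinl A r) = f r) /\
                              (forall a, h (RAinr A a) = g a).
Proof.
have fg c : f (algMap (resK R) c) = g (algMap A c) by rewrite [RHS]algFunE [LHS]algFunE.
pose h := @tcopair K (resK R) A C f g fg.
have hF c : h (algMap (RA A) c) = algMap C c by rewrite /= tcopair_inl algFunE.
by exists (AlgHom hF); split=> x /=; rewrite ?tcopair_inl ?tcopair_inr.
Qed.

Lemma TT_extend (X Y C : algOver F) (f : algHom X C) (g : algHom Y C) :
  exists h : algHom (tensAlg X Y) C, (forall r, h (tensInl X Y r) = f r) /\
                              (forall a, h (tensInr X Y a) = g a).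
Proof.
have fg c : f (algMap X c) = g (algMap Y c) by rewrite !algFunE.
pose h := @tcopair F X Y C f g fg.
have hF c : h (algMap (tensAlg X Y) c) = algMap C c by rewrite /= tcopair_inl algFunE.
by exists (AlgHom hF); split=> x /=; rewrite ?tcopair_inl ?tcopair_inr.
Qed.

Lemma RA_ext A (C : comPzRingType) (f g : {rmorphism RA A -> C}) :
  (forall r, f (RAinl A r) = g (RAinl A r)) -> (forall a, f (RAinr A a) = g (RAinr A a)) ->
  f =1 g.
Proof. exact: (@tens_rmorph_ext K (resK R) A C f g). Qed.

Lemma RA_der_ext A (C : comPzRingType) (dC : derivation C) (f : {rmorphism RA A -> C}) :
  (forall r, f (RAinl A (der R r)) = dC (f (RAinl A r))) ->
  (forall a, dC (f (RAinr A a)) = 0) ->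
  forall x, f (der (RtensA R A) x) = dC (f x).
Proof.
move=> hl hr; apply: (@tens_der_ext K (resK R) A C f (der (RtensA R A)) dC) => [r|a].
  by rewrite RtensA_der_inl [LHS]hl.
by rewrite RtensA_der_inr rmorph0 [RHS]hr.
Qed.

Lemma TT_der_ext (X Y : diffAlg d) (C : comPzRingType) (dC : derivation C)
    (f : {rmorphism tens X Y -> C}) :
  (forall x, f (tensInl X Y (der X x)) = dC (f (tensInl X Y x))) ->
  (forall y, f (tensInr X Y (der Y y)) = dC (f (tensInr X Y y))) ->
  forall t, f (der (tensDiffAlg X Y) t) = dC (f t).
Proof.
move=> hl hr; apply: (@tens_der_ext F X Y C f (der (tensDiffAlg X Y)) dC) => x.
  by rewrite tens_der_inl [LHS]hl.
by rewrite tens_der_inr [LHS]hr.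
Qed.

Lemma RA_der_inl A r : der (RtensA R A) (RAinl A r) = RAinl A (der R r).
Proof. exact: RtensA_der_inl. Qed.

Lemma RA_der_inr A a : der (RtensA R A) (RAinr A a) = 0.
Proof. exact: RtensA_der_inr. Qed.

(** Linearity over $F\otimes_K A$ is checked on the two factors: F is fixed because h is an
    F-algebra map, and A by assumption. Commutation with the derivation likewise reduces to R, since
    A is constant and fixed. *)
Lemma diffAut_of_algHom A (h : algHom (RA A) (RA A)) : bijective h ->
  (forall r, h (RAinl A (der R r)) = der (RtensA R A) (h (RAinl A r))) ->
  (forall a, h (RAinr A a) = RAinr A a) -> exists s : diffAut R A, s =1 h.
Proof.
move=> hb hl hr.
have hd x : h (der (RtensA R A) x) = der (RtensA R A) (h x).
  by apply: RA_der_ext x => // a; rewrite hr RA_der_inr.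
pose f : {rmorphism tens (resK (selfAlg F)) A -> RA A} := FtensA_RtensA R A.
have hlin y : h (FtensA_RtensA R A y) = FtensA_RtensA R A y.
  suff E : h \o f =1 f by exact: E.
  apply: tens_rmorph_ext => x.
    have E : f (@tinl K (resK (selfAlg F)) A x) = algMap (RA A) x.
      by rewrite /= tmap_pure rmorph1.
    by rewrite /= -/f E algFunE.
  have E : f (@tinr K (resK (selfAlg F)) A x) = RAinr A x by rewrite /= tmap_pure rmorph1.
  by rewrite /= -/f E hr.
by exists (@DiffAut F d R A h hb hd hlin).
Qed.

Lemma diffAut_inr A (s : diffAut R A) a : s (RAinr A a) = RAinr A a.
Proof.
have := aut_lin s (@tinr K (resK (selfAlg F)) A a).
by rewrite /= tmap_pure rmorph1.
Qed.

Fact diffAut_algMap A (s : diffAut R A) c : s (algMap (RA A) c) = algMap (RA A) c.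
Proof.
have := aut_lin s (@tinl K (resK (selfAlg F)) A c).
by rewrite /= tmap_pure rmorph1.
Qed.

Definition diffAutHom A (s : diffAut R A) : algHom (RA A) (RA A) :=
  @AlgHom F (RA A) (RA A) s (diffAut_algMap s).

Lemma diffAut_eq A (s t : diffAut R A) :
  (forall r, s (RAinl A r) = t (RAinl A r)) -> s = t.
Proof.
move=> st; apply: diffAut_ext; apply: (@RA_ext A _ (diffAutHom s) (diffAutHom t)) => // a.
by rewrite /= [LHS]diffAut_inr [RHS]diffAut_inr.
Qed.

(** As K is a field and R is nonzero, A embeds in $R\otimes_K A$; the values of f then determine g,
    which inherits the ring laws. This descends points of G from $R\otimes_K A$ to A. *)
Lemma RAinr_factor A (B : algOver K) (f : algHom B (resK (RA A))) : (1 : R) != 0 ->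
  (forall b, exists a, f b = RAinr A a) -> exists g : algHom B A, f = algComp (RAinr A) g.
Proof.
move=> R1 /choice [g gE].
have inj : injective (RAinr A) by exact: (@tinr_inj K (resK R) A).
have zm : zmod_morphism g.
  by move=> x y; apply: inj; rewrite -gE !rmorphB /= -!gE.
have mm : monoid_morphism g.
  split=> [|x y]; apply: inj; rewrite -gE ?rmorph1 // !rmorphM -!gE //.
pose h1 := GRing.isZmodMorphism.Build _ _ _ zm.
pose h2 := GRing.isMonoidMorphism.Build _ _ _ mm.
pose h : {rmorphism B -> A} := HB.pack g h1 h2.
have hK c : h (algMap B c) = algMap A c.
  apply: inj; transitivity (f (algMap B c)); first by rewrite gE.
  by rewrite algFunE; apply/esym; apply: RAinr_subproof.
by exists (AlgHom hK); apply: algHom_ext => b; rewrite gE.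
Qed.

End BaseChange.

(** * From torsors to Galois groups *)

Section CoordinateRing.
Variables (F : fieldType) (d : derivation F) (G : linAlgGroup (constField d)).
Notation K := (constField d).
Notation FK := (resAlg (constIncl d) (selfAlg F)).
Notation B := (coordRing G).

Lemma FG_der_pure (c : F) (b : B) :
  der (FG G) (@tpure K FK B c b) = @tpure K FK B (d c) b.
Proof.
rewrite [LHS](@tens_der_pure K (der0 K) (resDiffAlg (@constInclP F d) (selfDiffAlg d))
  (constDiffAlg B)).
by rewrite [X in _ + X](@tpure0r K FK B) addr0.
Qed.

Lemma FG_incl_der (b : B) : der (FG G) (FG_incl G b) = 0.
Proof. by rewrite [LHS]FG_der_pure der_1 (@tpure0l K FK B). Qed.

End CoordinateRing.

Section DifferentialTorsor.
Variables (F : fieldType) (d : derivation F).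
Notation K := (constField d).
Notation resK := (resAlg (constIncl d)).
Notation resHomK := (resHom (constIncl d)).
Variables (G : linAlgGroup K) (R : diffAlg d) (a : rightAction G R).
Notation B := (coordRing G).
Notation TT := (tensAlg R R).
Notation RB := (RA R B).

Hypothesis torsor_a : torsor a.
Hypothesis coact_der :
  forall x : R, coaction a (der R x) = der (tensDiffAlg R (FG G)) (coaction a x).

Lemma act_natE (X Y : algOver F) (f : algHom X Y) (x : algHom R X)
    (g : algHom B (resK X)) r :
  f (act a x g r) = act a (algComp f x) (algComp (resHomK f) g) r.
Proof. by rewrite -act_nat. Qed.

(** The co-action followed by evaluation of the group coordinates at g. At [algId B] it is the
    co-action itself, after identifying $R\otimes_F F[G]$ with $R\otimes_K K[G]$. *)
Definition translate (A : algOver K) (g : algHom B A) : algHom R (RA R A) :=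
  act a (RAinl R A) (algComp (RAinr R A) g).

Lemma translate_nat (A A' : algOver K) (f : algHom A A') (g : algHom B A) r :
  translate (algComp f g) r = RAmap R f (translate g r).
Proof.
rewrite /translate [RHS]act_natE; congr (act a _ _ r); apply: algHom_ext => x /=.
  by rewrite tmap_pure rmorph1.
by rewrite /tinr tmap_pure rmorph1.
Qed.

(** The hypothesis [coact_der] lives in $R\otimes_F F[G]$; it is transported to $R\otimes_K K[G]$
    along the map h, which is differential because it is so on R, on F and on the constants K[G]. *)
Lemma translate_id_der r :
  translate (algId B) (der R r) = der (RtensA R B) (translate (algId B) r).
Proof.
have fg c : algMap RB (algMap (resK (selfAlg F)) c) = RAinr R B (algMap B c).
  by rewrite [RHS]algFunE.
pose q := @tcopair K (resK (selfAlg F)) B RB (algMap RB) (RAinr R B) fg.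
have qF c : q (algMap (FG G) c) = algMap RB c by rewrite [LHS]tcopair_inl.
have [h [hl hr]] := @TT_extend F R (FG G) RB (RAinl R B) (AlgHom qF).
have hE x : translate (algId B) x = h (coaction a x).
  rewrite /coaction [RHS]act_natE /translate; congr (act a _ _ x).
    by apply: algHom_ext => y; apply/esym/hl.
  apply: algHom_ext => y; rewrite -[RHS]/(h (tensInr R (FG G) (FG_incl G y))) hr.
  by rewrite [RHS]tcopair_inr.
rewrite !hE coact_der.
apply: TT_der_ext => x; first by rewrite !hl RA_der_inl.
rewrite !hr.
apply: (@tens_der_ext K (resK (selfAlg F)) B _ q (der (FG G)) (der (RtensA R B))) => y.
  by rewrite FG_der_pure [LHS]tcopair_inl [q _]tcopair_inl [RHS]RtensA_der_inl /= derMap.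
rewrite FG_der_pure der_1 [X in q X](@tpure0l K (resK (selfAlg F)) B) rmorph0.
by rewrite [q _]tcopair_inr [RHS]RA_der_inr.
Qed.

(** Yoneda: g is the image of the tautological point [algId B] under g itself, and base change along
    g commutes with the derivations. *)
Lemma translate_der (A : algOver K) (g : algHom B A) r :
  translate g (der R r) = der (RtensA R A) (translate g r).
Proof.
have -> : g = algComp g (algId B) by apply: algHom_ext.
by rewrite !translate_nat translate_id_der RAmap_der.
Qed.

Lemma sigma_exists (A : algOver K) (g : algHom B A) :
  exists h : algHom (RA R A) (RA R A),
    (forall r, h (RAinl R A r) = translate g r) /\
    (forall x, h (RAinr R A x) = RAinr R A x).
Proof. exact: RA_extend. Qed.

Definition sigma (A : algOver K) (g : algHom B A) : algHom (RA R A) (RA R A) :=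
  sval (cid (sigma_exists g)).

Lemma sigma_inl (A : algOver K) (g : algHom B A) r :
  sigma g (RAinl R A r) = translate g r.
Proof. by case: (svalP (cid (sigma_exists g))). Qed.

Lemma sigma_inr (A : algOver K) (g : algHom B A) x :
  sigma g (RAinr R A x) = RAinr R A x.
Proof. by case: (svalP (cid (sigma_exists g))). Qed.

(** A right action on points is a left action on functions, hence a homomorphism rather than an
    anti-homomorphism: [sigma g] carries the point [RAinl] to its translate by g and fixes A, so it
    turns the translate by h into the translate by gh. *)
Lemma sigma_mul (A : algOver K) (g h : algHom B A) x :
  sigma (gmul G g h) x = sigma g (sigma h x).
Proof.
apply: (@RA_ext _ _ R A _ (sigma (gmul G g h)) (algComp (sigma g) (sigma h))) => y.
  rewrite sigma_inl -[RHS]/(sigma g (sigma h (RAinl R A y))) sigma_inl.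
  rewrite /translate gmul_nat actM [RHS]act_natE; congr (act a _ _ y).
    by apply: algHom_ext => r; apply/esym/sigma_inl.
  by apply: algHom_ext => r; apply/esym/sigma_inr.
by rewrite sigma_inr -[RHS]/(sigma g (sigma h (RAinr R A y))) !sigma_inr.
Qed.

Lemma sigma_one (A : algOver K) x : sigma (gone G A) x = x.
Proof.
apply: (@RA_ext _ _ R A _ (sigma (gone G A)) (algId (RA R A))) => y.
  by rewrite sigma_inl /translate gone_nat act1.
by rewrite sigma_inr.
Qed.

Lemma sigma_bij (A : algOver K) (g : algHom B A) : bijective (sigma g).
Proof.
by exists (sigma (ginv g)) => x; rewrite -sigma_mul ?gmulV ?gmulgV sigma_one.
Qed.

Lemma theta_exists (A : algOver K) (g : algHom B A) :
  exists s : diffAut R A, s =1 sigma g.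
Proof.
apply: diffAut_of_algHom; [exact: sigma_bij| |exact: sigma_inr].
by move=> r; rewrite !sigma_inl translate_der.
Qed.

Definition theta (A : algOver K) (g : algHom B A) : diffAut R A :=
  sval (cid (theta_exists g)).

Lemma thetaE (A : algOver K) (g : algHom B A) : theta g =1 sigma g.
Proof. exact: (svalP (cid (theta_exists g))). Qed.

(** The two inclusions of R in $R\otimes_F R$ are points of the torsor, and the unique [gam] between
    them defines [Psi] on K[G]. The inverse sends the second inclusion to the universal translate;
    it is differential, so [Psi] maps the constants K[G] to constants. *)
Lemma torsor_iso : exists (Psi : algHom RB TT) (Phi : algHom TT RB),
  [/\ forall r, Psi (RAinl R B r) = tensInl R R r,
      cancel Psi Phi, cancel Phi Psi,
      forall b, der (tensDiffAlg R R) (Psi (RAinr R B b)) = 0 &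
      tensInr R R = act a (tensInl R R) (algComp (resHomK Psi) (RAinr R B)) ].
Proof.
have [_ _ act_uniq] := torsor_a.
have [gam [gamE _]] := act_uniq TT (tensInl R R) (tensInr R R).
have [Psi [Psil Psir]] := RA_extend (tensInl R R) gam.
have [Phi [Phil Phir]] := TT_extend (RAinl R B) (translate (algId B)).
(* Both sides carry the point [RAinl] to its universal translate, so uniqueness in the torsor
   condition identifies them. *)
have Phigam : algComp (resHomK Phi) gam = RAinr R B.
  have [g0 [_ g0uniq]] := act_uniq RB (RAinl R B) (translate (algId B)).
  transitivity g0; [apply/esym; apply: g0uniq|apply: g0uniq].
    apply: algHom_ext => r; rewrite -Phir gamE act_natE; congr (act a _ _ r).
    by apply: algHom_ext => x; exact: Phil.
  by rewrite /translate; congr (act a _ _); apply: algHom_ext.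
have PsiE : algComp (resHomK Psi) (RAinr R B) = gam.
  by apply: algHom_ext => b; exact: Psir.
have PsiK : cancel Psi Phi.
  apply: (@RA_ext _ _ R B _ (algComp Phi Psi) (algId RB)) => x.
    by rewrite -[LHS]/(Phi (Psi (RAinl R B x))) Psil Phil.
  rewrite -[LHS]/(Phi (Psi (RAinr R B x))) Psir.
  exact: (congr1 (fun f : algHom B (resK RB) => f x) Phigam).
have PhiK : cancel Phi Psi.
  apply: (@tens_rmorph_ext F R R _ (algComp Psi Phi) (algId TT)) => x.
    by rewrite -[LHS]/(Psi (Phi (tensInl R R x))) Phil Psil.
  rewrite -[LHS]/(Psi (Phi (tensInr R R x))) Phir -[RHS]/(tensInr R R x) gamE.
  rewrite /translate act_natE; congr (act a _ _ x); apply: algHom_ext => y.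
    exact: Psil.
  exact: Psir.
have Phid x : Phi (der (tensDiffAlg R R) x) = der (RtensA R B) (Phi x).
  apply: TT_der_ext => r; first by rewrite !Phil RA_der_inl.
  by rewrite !Phir translate_der.
exists Psi, Phi; split=> // [b|]; last by rewrite PsiE.
by rewrite -[LHS]PhiK Phid PsiK RtensA_der_inr rmorph0.
Qed.

Hypotheses (constR : constants_eq_K R).

(** Injectivity of [theta] is the uniqueness in the torsor condition. For surjectivity, the point of
    G between [RAinl] and its image under s is obtained from the constants of $R\otimes_F R$ by a
    differential map; it has constant values in $R\otimes_K A$, hence values in A. *)
Lemma torsor_galois_group : galois_group R G.
Proof.
have [R1 _ act_uniq] := torsor_a.
exists theta; split=> [A|A g h x|A A' f g x]; last 2 first.
- by rewrite [LHS]thetaE sigma_mul [LHS]/= -!thetaE.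
- rewrite [LHS]thetaE thetaE.
  apply: (@RA_ext _ _ R A _ (algComp (sigma (algComp f g)) (RAmap R f))
    (algComp (RAmap R f) (sigma g))) => y.
    rewrite -[LHS]/(sigma _ (RAmap R f (RAinl R A y))) RAmap_inl.
    rewrite -[RHS]/(RAmap R f (sigma g (RAinl R A y))) !sigma_inl.
    exact: translate_nat.
  rewrite -[LHS]/(sigma _ (RAmap R f (RAinr R A y))) RAmap_inr.
  by rewrite -[RHS]/(RAmap R f (sigma g (RAinr R A y))) !sigma_inr RAmap_inr.
apply: inj_surj_bij => [g h gh|s].
  have tgh : translate g = translate h.
    by apply: algHom_ext => r; rewrite -!sigma_inl -!thetaE gh.
  have [g0 [_ g0uniq]] := act_uniq (RA R A) (RAinl R A) (translate g).
  have E : algComp (RAinr R A) g = algComp (RAinr R A) h.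
    by rewrite -(g0uniq (algComp (RAinr R A) g)) // -(g0uniq (algComp (RAinr R A) h)).
  apply: algHom_ext => b; apply: (@tinr_inj K (resK R) A R1).
  exact: (congr1 (fun f : algHom B (resK (RA R A)) => f b) E).
pose y : algHom R (RA R A) := algComp (diffAutHom s) (RAinl R A).
have [Psi [Phi [Psil _ _ Psic gamE]]] := torsor_iso.
have [c [cl cr]] := TT_extend (RAinl R A) y.
pose gam := algComp (resHomK Psi) (RAinr R B).
have yE : y = act a (RAinl R A) (algComp (resHomK c) gam).
  apply: algHom_ext => r; rewrite -cr gamE act_natE; congr (act a _ _ r).
  by apply: algHom_ext => x; exact: cl.
have cd x : c (der (tensDiffAlg R R) x) = der (RtensA R A) (c x).
  apply: TT_der_ext => r; first by rewrite !cl RA_der_inl.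
  by rewrite !cr /y /= -[RHS]aut_der [in RHS]RtensA_der_inl.
have [b|g gE] := @RAinr_factor F d R A B (algComp (resHomK c) gam) R1.
  apply: (const_RtensA constR).
  by rewrite -[LHS]cd Psic rmorph0.
exists g; apply: diffAut_eq => r.
by rewrite thetaE sigma_inl /translate -gE -yE.
Qed.

Lemma torsor_picard_vessiot : [pchar F] =i pred0 -> simple_diff (der R) ->
  picard_vessiot R.
Proof.
move=> charF simpleR; have [R1 ftR _] := torsor_a.
have [Psi [Phi [Psil PsiK PhiK Psic _]]] := torsor_iso.
apply: (@picard_vessiot_of_const_tens F d R B Psi) => //.
  by move=> x; exists (Phi x); rewrite PhiK.
exact: can_inj PsiK.
Qed.

End DifferentialTorsor.

(** * From Picard-Vessiot rings to torsors *)

Section ConstantRing.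
Variables (A : comPzRingType) (dA : derivation A).

Definition der_const : {pred A} := fun x => dA x == 0.

Fact der_const_subring : subring_closed der_const.
Proof.
split=> [|x y /eqP hx /eqP hy|x y /eqP hx /eqP hy]; apply/eqP.
- exact: der_1.
- by rewrite derD derN hx hy subr0.
- by rewrite derM hx hy mul0r mulr0 addr0.
Qed.

HB.instance Definition _ := GRing.isSubringClosed.Build A der_const der_const_subring.

Record constRing := ConstRing { constRingVal :> A; constRingValP : constRingVal \in der_const }.

HB.instance Definition _ := [isSub for constRingVal].
HB.instance Definition _ := [Choice of constRing by <:].
HB.instance Definition _ :=
  GRing.SubChoice_isSubComPzRing.Build A der_const constRing der_const_subring.

Lemma constRingP (x : constRing) : dA (val x) = 0.
Proof. by apply/eqP/constRingValP. Qed.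

End ConstantRing.

Lemma der_mulmx (A : comPzRingType) (dA : derivation A) m n p
    (M : 'M[A]_(m, n)) (N : 'M[A]_(n, p)) :
  map_mx dA (M *m N) = map_mx dA M *m N + M *m map_mx dA N.
Proof.
apply/matrixP => i j; rewrite !mxE der_sum -big_split; apply: eq_bigr => k _.
by rewrite derM !mxE.
Qed.

Section AlgHomInverse.
Variables (k : comPzRingType) (A B : algOver k) (f : algHom A B).

Lemma algHom_inv : bijective f -> exists g : algHom B A, cancel f g /\ cancel g f.
Proof.
move=> [g fK gK]; have inj := can_inj fK.
have zm : zmod_morphism g by move=> x y; apply: inj; rewrite rmorphB !gK.
have mm : monoid_morphism g.
  by split=> [|x y]; apply: inj; rewrite ?rmorph1 ?rmorphM !gK.
pose h1 := GRing.isZmodMorphism.Build _ _ _ zm.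
pose h2 := GRing.isMonoidMorphism.Build _ _ _ mm.
pose h : {rmorphism B -> A} := HB.pack g h1 h2.
have hk c : h (algMap B c) = algMap A c by apply: inj; rewrite algFunE [LHS]gK.
by exists (AlgHom hk).
Qed.

End AlgHomInverse.

Section PicardVessiotTorsor.
Variables (F : fieldType) (d : derivation F).
Notation K := (constField d).
Notation resK := (resAlg (constIncl d)).
Notation resHomK := (resHom (constIncl d)).
Variable R : diffAlg d.
Notation TT := (tensAlg R R).
Notation dTT := (der (tensDiffAlg R R)).

Variables (n : nat) (Z W : 'M[R]_n) (u : R) (M : 'M[F]_n).
Hypotheses (ZW : Z *m W = 1%:M) (WZ : W *m Z = 1%:M)
  (dZW : map_mx (der R) Z *m W = map_mx (algMap R) M) (uZ : u * \det Z = 1)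
  (genR : generates (fun x : R => (exists i j, x = Z i j) \/ x = u)).

Lemma der_fundamental : map_mx (der R) Z = map_mx (algMap R) M *m Z.
Proof. by rewrite -dZW -mulmxA WZ mulmx1. Qed.

Lemma der_fundamental_inv : map_mx (der R) W = - (W *m map_mx (algMap R) M).
Proof.
have : map_mx (der R) (W *m Z) *m W = 0.
  have -> : map_mx (der R) (W *m Z) = 0.
    apply/matrixP => i j; rewrite WZ !mxE.
    by case: (i == j); rewrite ?mulr1n ?mulr0n ?der_1 ?der_0.
  by rewrite mul0mx.
rewrite der_mulmx mulmxDl -!mulmxA ZW mulmx1 dZW => /eqP.
by rewrite addr_eq0 => /eqP.
Qed.

(** Since f and g agree on F, both images of Z solve the same linear system, and the two terms in
    the derivative of $f(Z)^{-1}g(Z)$ cancel. *)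
Lemma fundamental_ratio_const (S : comPzRingType) (dS : derivation S)
    (f g : {rmorphism R -> S}) :
  (forall r, f (der R r) = dS (f r)) -> (forall r, g (der R r) = dS (g r)) ->
  (forall c, f (algMap R c) = g (algMap R c)) ->
  forall i j, dS ((map_mx f W *m map_mx g Z) i j) = 0.
Proof.
move=> fd gd fg i j.
suff E : map_mx dS (map_mx f W *m map_mx g Z) = 0.
  by have := congr1 (fun N : 'M_n => N i j) E; rewrite !mxE.
have dmap (h : {rmorphism R -> S}) (hd : forall r, h (der R r) = dS (h r)) (N : 'M[R]_n) :
    map_mx dS (map_mx h N) = map_mx h (map_mx (der R) N).
  by apply/matrixP => k l; rewrite !mxE hd.
rewrite der_mulmx (dmap f fd) (dmap g gd) der_fundamental der_fundamental_inv.
rewrite map_mxN !map_mxM /= mulNmx -mulmxA.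
have -> : map_mx f (map_mx (algMap R) M) = map_mx g (map_mx (algMap R) M).
  by apply/matrixP => k l; rewrite !mxE fg.
by rewrite addrC subrr.
Qed.

Lemma det_W : \det W = u.
Proof. by rewrite -[LHS]mul1r -uZ -mulrA -det_mulmx ZW det1 mulr1. Qed.

Lemma gen_ext (S : comPzRingType) (f g : {rmorphism R -> S}) :
  (forall c, f (algMap R c) = g (algMap R c)) -> (forall i j, f (Z i j) = g (Z i j)) ->
  f =1 g.
Proof.
move=> fgF fgZ; apply: genR => // [x y xE yE|x y xE yE|x [[i [j ->]]|->]] //.
- by rewrite !rmorphD xE yE.
- by rewrite !rmorphM xE yE.
have detE : f (\det Z) = g (\det Z).
  by rewrite -!det_map_mx; congr (\det _); apply/matrixP => i j; rewrite !mxE.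
have fu : f u * f (\det Z) = 1 by rewrite -rmorphM uZ rmorph1.
have gu : g u * g (\det Z) = 1 by rewrite -rmorphM uZ rmorph1.
by rewrite -[LHS]mulr1 -gu mulrCA -detE fu mulr1.
Qed.

Lemma finite_type_of_fundamental : finite_type R.
Proof.
exists (u :: [seq Z i j | i <- enum 'I_n, j <- enum 'I_n]) => S S0 SD SM Sg.
apply: genR => // x [[i [j ->]]|->]; apply: Sg; rewrite inE ?eqxx //.
by apply/orP; right; apply/allpairsP; exists (i, j); rewrite !mem_enum.
Qed.

Hypotheses (simpleR : simple_diff (der R)) (constR : constants_eq_K R).
Hypothesis R1 : (1 : R) != 0.

Local Notation C0 := (constRing dTT).

Fact constTT_algMap : exists i : {rmorphism K -> C0},
  forall c, val (i c) = tensInl R R (algMap R (constIncl d c)).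
Proof.
pose e (c : K) : tens R R := tensInl R R (algMap R (constIncl d c)).
have ec c : e c \in der_const dTT.
  apply/eqP; rewrite [LHS]tens_der_inl derMap constInclP rmorph0.
  exact: rmorph0 (tensInl R R).
pose i c : C0 := ConstRing (ec c).
have zm : zmod_morphism i by move=> x y; apply: val_inj; rewrite /= /e !rmorphB.
have mm : monoid_morphism i.
  by split=> [|x y]; apply: val_inj; rewrite /= /e ?rmorph1 ?rmorphM.
pose h1 := GRing.isZmodMorphism.Build _ _ _ zm.
pose h2 := GRing.isMonoidMorphism.Build _ _ _ mm.
by exists (HB.pack i h1 h2 : {rmorphism K -> C0}).
Qed.

Definition constTT : algOver K := AlgOver (sval (cid constTT_algMap)).

Fact constTT_incl_subproof c :
  (val : C0 -> tens R R) (algMap constTT c) = algMap (resK TT) c.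
Proof. exact: (svalP (cid constTT_algMap)). Qed.

Definition constTT_incl : algHom constTT (resK TT) :=
  @AlgHom K constTT (resK TT) (val : {rmorphism C0 -> tens R R}) constTT_incl_subproof.

(** The kernel of [Psi] is a d-stable submodule, so the key fact spans it by constants that [Psi]
    sends to 0; as [Psi] is the inclusion on constants, it is injective. It is onto because
    $1\otimes Z$ is $Z\otimes 1$ times a constant matrix. *)
Lemma fundamental_iso : exists (Psi : algHom (RA R constTT) TT) (Phi : algHom TT (RA R constTT)),
  [/\ forall r, Psi (RAinl R constTT r) = tensInl R R r,
      forall c, Psi (RAinr R constTT c) = constTT_incl c,
      cancel Phi Psi & forall x, Phi (dTT x) = der (RtensA R constTT) (Phi x)].
Proof.
have [Psi [Psil Psir]] := RA_extend (tensInl R R) constTT_incl.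
have Psid x : Psi (der (RtensA R constTT) x) = dTT (Psi x).
  apply: RA_der_ext => [r|c]; first by rewrite !Psil [RHS]tens_der_inl.
  by rewrite Psir; apply: constRingP.
have inj : injective Psi.
  suff ker x : Psi x = 0 -> x = 0.
    by move=> x y xy; apply/eqP; rewrite -subr_eq0; apply/eqP/ker; rewrite rmorphB xy subrr.
  move=> x0; apply: tsub_set0.
  have := @diff_submodule_tsub F d R constTT constR simpleR (fun x => Psi x = 0).
  move=> /(_ _ _ _ _ x x0) h.
  have {h} : tsub (fun c => Psi (RAinr R constTT c) = 0) x.
    apply: h => [|y z y0 z0|r y y0|y y0].
    - exact: rmorph0.
    - by rewrite [LHS]rmorphD y0 z0 addr0.
    - by rewrite [LHS]rmorphM y0 mulr0.
    - by rewrite Psid y0 der_0.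
  move=> [s [sP ->]]; exists s; split=> // p /sP; rewrite Psir => p0.
  by apply: val_inj; rewrite [RHS]raddf0; exact: p0.
have imc (x : tens R R) : dTT x = 0 -> exists t, Psi t = x.
  move=> dx; have xc : x \in der_const dTT by apply/eqP.
  by exists (RAinr R constTT (ConstRing xc)); rewrite Psir.
have imM (x y : tens R R) : (exists t, Psi t = x) -> (exists t, Psi t = y) ->
    exists t, Psi t = x * y.
  by move=> [t <-] [t' <-]; exists (t * t'); rewrite rmorphM.
have imD (x y : tens R R) : (exists t, Psi t = x) -> (exists t, Psi t = y) ->
    exists t, Psi t = x + y.
  by move=> [t <-] [t' <-]; exists (t + t'); rewrite rmorphD.
have iml r : exists t, Psi t = tensInl R R r by exists (RAinl R constTT r).
have inlr c : tensInl R R (algMap R c) = tensInr R R (algMap R c) by rewrite !algFunE.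
have dl r : tensInl R R (der R r) = dTT (tensInl R R r) by apply/esym; apply: tens_der_inl.
have dr r : tensInr R R (der R r) = dTT (tensInr R R r) by apply/esym; apply: tens_der_inr.
have imr r : exists t, Psi t = tensInr R R r.
  move: r; apply: genR => [c|x y|x y|x [[i [j ->]]|->]].
  - by rewrite -inlr; apply: iml.
  - by rewrite rmorphD; apply: imD.
  - by rewrite rmorphM; apply: imM.
  - pose Y := map_mx (tensInl R R) W *m map_mx (tensInr R R) Z.
    have : map_mx (tensInl R R) Z *m Y = map_mx (tensInr R R) Z.
      by rewrite /Y mulmxA -map_mxM ZW map_mx1 mul1mx.
    move/(congr1 (fun N : 'M_n => N i j)); rewrite !mxE => <-.
    elim/big_ind: _ => [|//|k _]; first by exists 0; rewrite rmorph0.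
    rewrite mxE; apply: imM; first exact: iml.
    by apply: imc; apply: (fundamental_ratio_const dl dr inlr).
  (* The ratio is reversed here because u is the inverse of $\det Z$: the determinant of Y is $\det
     Z\otimes u$, a constant, and multiplying it by $u\otimes 1$ gives $1\otimes u$. *)
  - pose Y := map_mx (tensInr R R) W *m map_mx (tensInl R R) Z.
    have -> : tensInr R R u = tensInl R R u * \det Y.
      rewrite det_mulmx !det_map_mx det_W mulrCA -[X in _ * X]rmorphM uZ rmorph1 mulr1 //.
    apply: imM; first exact: iml.
    apply: imc; apply/eqP; rewrite -[_ == 0]/(_ \in der_const dTT).
    apply: rpred_sum => s _; apply: rpredM; first by rewrite rpredX // rpredN rpred1.
    apply: rpred_prod => i _; apply/eqP.
    by apply: (fundamental_ratio_const dr dl) => c; rewrite inlr.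
have bij : bijective Psi.
  apply: inj_surj_bij => // x; rewrite (tens_sumE x).
  elim/big_ind: _ => [|//|p _]; first by exists 0; rewrite rmorph0.
  rewrite tpure_lr; apply: imM; first exact: iml.
  exact: imr.
have [Phi [PsiK PhiK]] := algHom_inv bij.
exists Psi, Phi; split=> // x.
by apply: (can_inj PsiK); rewrite PhiK Psid PhiK.
Qed.

(** The A-linear extension of the point x to $R\otimes_K A$, through which automorphisms of
    $R\otimes_K A$ move x. *)
Definition RAev (A : algOver F) (x : algHom R A) : algHom (RA R (resK A)) A :=
  sval (cid (RA_extend x (algId (resK A)))).

Lemma RAev_inl (A : algOver F) (x : algHom R A) r : RAev x (RAinl R _ r) = x r.
Proof. by rewrite /RAev; case: cid => h []. Qed.

Lemma RAev_inr (A : algOver F) (x : algHom R A) b : RAev x (RAinr R _ b) = b.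
Proof. by rewrite /RAev; case: cid => h []. Qed.

(** Both maps send Z to $Z\otimes 1$ times a matrix of constants, that is, a matrix over A.
    Evaluation at x recovers this matrix because x(Z) is invertible, so equal evaluations force
    equal maps. *)
Lemma diffHom_uniq (A : algOver F) (x : algHom R A) (s t : algHom R (RA R (resK A))) :
  (forall r, s (der R r) = der (RtensA R (resK A)) (s r)) ->
  (forall r, t (der R r) = der (RtensA R (resK A)) (t r)) ->
  (forall r, RAev x (s r) = RAev x (t r)) -> s =1 t.
Proof.
move=> sd td st; apply: gen_ext => [c|]; first by rewrite !algFunE.
have ratio (f : algHom R (RA R (resK A))) :
    (forall r, f (der R r) = der (RtensA R (resK A)) (f r)) ->
    exists N : 'M[A]_n, map_mx (RAinl R (resK A)) W *m map_mx f Z = map_mx (RAinr R (resK A)) N.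
  move=> fd; have cst i j : exists b, (map_mx (RAinl R (resK A)) W *m map_mx f Z) i j =
      RAinr R (resK A) b.
    apply: (const_RtensA constR).
    apply: (fundamental_ratio_const (dS := der (RtensA R (resK A)))) => // [r|c].
      by rewrite -RA_der_inl.
    by rewrite !algFunE.
  have [N NE] := choice (fun ij : 'I_n * 'I_n => cst ij.1 ij.2).
  by exists (\matrix_(i, j) N (i, j)); apply/matrixP => i j; rewrite (NE (i, j)) !mxE.
have [N sN] := ratio s sd; have [N' tN] := ratio t td.
have back (f : algHom R (RA R (resK A))) :
    map_mx f Z = map_mx (RAinl R (resK A)) Z *m (map_mx (RAinl R (resK A)) W *m map_mx f Z).
  by rewrite mulmxA -map_mxM ZW map_mx1 mul1mx.
have NN : N = N'.
  have ev (f : algHom R (RA R (resK A))) P :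
      map_mx (RAinl R (resK A)) W *m map_mx f Z = map_mx (RAinr R (resK A)) P ->
      P = map_mx x W *m map_mx (algComp (RAev x) f) Z.
    move/(congr1 (map_mx (RAev x))); rewrite map_mxM => E.
    transitivity (map_mx (RAev x) (map_mx (RAinr R (resK A)) P)).
      by apply/matrixP => i j; rewrite !mxE RAev_inr.
    rewrite -E; congr (_ *m _); apply/matrixP => i j; rewrite !mxE //.
    by rewrite RAev_inl.
  rewrite (ev s N sN) (ev t N' tN); congr (_ *m _).
  by apply/matrixP => i j; rewrite !mxE; apply: st.
move=> i j; have E : map_mx s Z = map_mx t Z by rewrite back sN NN -tN -back.
by have := congr1 (fun P : 'M_n => P i j) E; rewrite !mxE.
Qed.

Lemma shift_exists (A : algOver F) (x y : algHom R A) :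
  exists s : diffAut R (resK A), forall r, RAev x (s (RAinl R _ r)) = y r.
Proof.
have [Psi [Phi [Psil Psir PhiK Phid]]] := fundamental_iso.
have sh x' y' : exists h : algHom (RA R (resK A)) (RA R (resK A)),
    [/\ forall r, h (RAinl R _ (der R r)) = der (RtensA R (resK A)) (h (RAinl R _ r)),
        forall b, h (RAinr R _ b) = RAinr R _ b &
        forall t, RAev x' (h t) = RAev y' t].
  have [c [cl cr]] := TT_extend x' y'.
  (* Evaluating the constants of $R\otimes_F R$ at the pair of points (x', y') turns the image of
     $1\otimes r$ in $R\otimes_K C$ into an element of $R\otimes_K A$. *)
  pose cC := algComp (resHomK c) constTT_incl.
  have [h [hl hr]] := RA_extend (algComp (RAmap R cC) (algComp Phi (tensInr R R)))
    (RAinr R (resK A)).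
  have hlE r : h (RAinl R _ r) = RAmap R cC (Phi (tensInr R R r)) by rewrite hl.
  exists h; split=> // [r|].
    by rewrite !hlE -RAmap_der -Phid; congr (RAmap R cC (Phi _)); apply/esym/tens_der_inr.
  apply: (@RA_ext _ _ R (resK A) _ (algComp (RAev x') h) (RAev y')) => r; last first.
    by rewrite -[LHS]/(RAev x' (h (RAinr R _ r))) hr !RAev_inr.
  rewrite -[LHS]/(RAev x' (h (RAinl R _ r))) hlE RAev_inl.
  have E : algComp (RAev x') (RAmap R cC) =1 algComp c Psi.
    apply: (@RA_ext _ _ R constTT) => z.
      rewrite -[LHS]/(RAev x' (RAmap R cC (RAinl R _ z))) RAmap_inl RAev_inl.
      by rewrite -[RHS]/(c (Psi (RAinl R _ z))) Psil cl.
    rewrite -[LHS]/(RAev x' (RAmap R cC (RAinr R _ z))) RAmap_inr RAev_inr.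
    by rewrite -[RHS]/(c (Psi (RAinr R _ z))) Psir.
  by rewrite [LHS]E -[LHS]/(c (Psi (Phi (tensInr R R r)))) PhiK cr.
have [h [hd hr hev]] := sh x y; have [h' [h'd h'r h'ev]] := sh y x.
(* Exchanging the two points gives the inverse: the composite and the identity are differential on R
   and agree after evaluation at x', so [diffHom_uniq] applies. *)
have comp_id x' y' (f g : algHom (RA R (resK A)) (RA R (resK A))) :
    (forall r, f (RAinl R _ (der R r)) = der (RtensA R (resK A)) (f (RAinl R _ r))) ->
    (forall r, g (RAinl R _ (der R r)) = der (RtensA R (resK A)) (g (RAinl R _ r))) ->
    (forall b, f (RAinr R _ b) = RAinr R _ b) ->
    (forall b, g (RAinr R _ b) = RAinr R _ b) ->
    (forall t, RAev x' (f t) = RAev y' t) -> (forall t, RAev y' (g t) = RAev x' t) ->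
    cancel g f.
  move=> fd gd fr gr fev gev.
  have fder t : f (der (RtensA R (resK A)) t) = der (RtensA R (resK A)) (f t).
    by apply: RA_der_ext => // b; rewrite fr RA_der_inr.
  apply: (@RA_ext _ _ R (resK A) _ (algComp f g) (algId _)) => r; last first.
    by rewrite -[LHS]/(f (g (RAinr R _ r))) gr fr.
  apply: (diffHom_uniq (x := x') (s := algComp (algComp f g) (RAinl R (resK A)))
    (t := RAinl R (resK A))) => z.
  - by rewrite -[LHS]/(f (g (RAinl R _ (der R z)))) gd fder.
  - by rewrite RA_der_inl.
  - by rewrite -[X in RAev _ X]/(f (g (RAinl R _ z))) fev gev.
have hb : bijective h.
  by exists h'; [apply: (comp_id y x)|apply: (comp_id x y)].
have [s sE] := diffAut_of_algHom hb hd hr.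
by exists s => r; rewrite sE hev RAev_inl.
Qed.

Variables (G : linAlgGroup K)
  (theta : forall A : algOver K, algHom (coordRing G) A -> diffAut R A).
Notation B := (coordRing G).
Hypotheses (theta_bij : forall A, bijective (@theta A))
  (thetaM : forall A (g h : algHom B A) x,
     theta (gmul G g h) x = theta g (theta h x))
  (theta_nat : forall (A A' : algOver K) (f : algHom A A') (g : algHom B A) x,
     theta (algComp f g) (RtensMap R f x) = RtensMap R f (theta g x)).

Definition galois_act (A : algOver F) (x : algHom R A) (g : algHom B (resK A)) :
  algHom R A := algComp (RAev x) (algComp (diffAutHom (theta g)) (RAinl R (resK A))).

Lemma galois_actE (A : algOver F) (x : algHom R A) g r :
  galois_act x g r = RAev x (theta g (RAinl R (resK A) r)).
Proof. by []. Qed.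

Lemma galois_act_ev (A : algOver F) (x : algHom R A) g t :
  RAev (galois_act x g) t = RAev x (theta g t).
Proof.
apply: (@RA_ext _ _ R (resK A) _ (RAev (galois_act x g))
  (algComp (RAev x) (diffAutHom (theta g)))) => r.
  by rewrite RAev_inl.
by rewrite RAev_inr -[RHS]/(RAev x (theta g (RAinr R _ r))) diffAut_inr RAev_inr.
Qed.

Lemma theta_one A x : theta (gone G A) x = x.
Proof.
by apply: (bij_inj (aut_bij (theta (gone G A)))); rewrite -thetaM gmul1.
Qed.

Fact galois_act1 (A : algOver F) (x : algHom R A) : galois_act x (gone G (resK A)) = x.
Proof. by apply: algHom_ext => r; rewrite galois_actE theta_one RAev_inl. Qed.

Fact galois_actM (A : algOver F) (x : algHom R A) (g h : algHom B (resK A)) :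
  galois_act x (gmul G g h) = galois_act (galois_act x g) h.
Proof. by apply: algHom_ext => r; rewrite !galois_actE galois_act_ev thetaM. Qed.

Fact galois_act_nat (A A' : algOver F) (f : algHom A A') (x : algHom R A)
    (g : algHom B (resK A)) :
  algComp f (galois_act x g) = galois_act (algComp f x) (algComp (resHomK f) g).
Proof.
apply: algHom_ext => r; rewrite galois_actE -[LHS]/(f (galois_act x g r)) galois_actE.
have -> : RAinl R (resK A') r = RAmap R (resHomK f) (RAinl R (resK A) r).
  by rewrite RAmap_inl.
rewrite [theta (algComp _ _) _]theta_nat.
apply: (@RA_ext _ _ R (resK A) _ (algComp f (RAev x))
  (algComp (RAev (algComp f x)) (RAmap R (resHomK f)))) => z.
  rewrite -[LHS]/(f (RAev x (RAinl R _ z))) RAev_inl.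
  by rewrite -[RHS]/(RAev _ (RAmap R _ (RAinl R _ z))) RAmap_inl RAev_inl.
rewrite -[LHS]/(f (RAev x (RAinr R _ z))) RAev_inr.
by rewrite -[RHS]/(RAev _ (RAmap R _ (RAinr R _ z))) RAmap_inr RAev_inr.
Qed.

Definition galois_action : rightAction G R :=
  RightAction galois_act1 galois_actM galois_act_nat.

(** Through the bijection [theta], existence of the translating point is [shift_exists] and its
    uniqueness is [diffHom_uniq]. *)
Lemma galois_torsor : torsor galois_action.
Proof.
split=> // [|A x y]; first exact: finite_type_of_fundamental.
have [s sy] := shift_exists x y; have [thinv thK thK'] := theta_bij (resK A).
exists (thinv s); split=> [|g gE].
  by apply: algHom_ext => r; rewrite -sy -[s in LHS]thK'.
rewrite -[g]thK; congr thinv; apply: diffAut_eq => r.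
pose f (s' : diffAut R (resK A)) := algComp (diffAutHom s') (RAinl R (resK A)).
have fd s' z : f s' (der R z) = der (RtensA R (resK A)) (f s' z).
  by rewrite -[RHS]aut_der [in RHS]RtensA_der_inl.
apply: (diffHom_uniq (x := x) (fd s) (fd (theta g))) => z.
by rewrite [LHS]sy gE.
Qed.

Lemma galois_diff_torsor : diff_torsor G R.
Proof.
exists galois_action; split=> [|x]; first exact: galois_torsor.
pose A : algOver F := tensDiffAlg R (FG G).
pose g : algHom B (resK A) := algComp (resHomK (tensInr R (FG G))) (FG_incl G).
(* By naturality the co-action is the universal automorphism [theta (algId B)] restricted to R,
   followed by q; and q is differential because K[G] is constant in F[G]. *)
pose q := algComp (RAev (tensInl R (FG G))) (RAmap R g).
have coactE r : coaction galois_action r = q (theta (algId B) (RAinl R B r)).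
  rewrite /coaction [LHS]galois_actE -[RHS]/(RAev _ (RAmap R g _)).
  congr (RAev _ _); rewrite -[RHS]theta_nat -(RAmap_inl (R:=R) g).
  by congr (autFun (theta _) _); apply: algHom_ext.
rewrite !coactE.
have qd t : q (der (RtensA R B) t) = der (tensDiffAlg R (FG G)) (q t).
  apply: RA_der_ext => [r|b].
    rewrite -[LHS]/(RAev _ (RAmap R g (RAinl R _ _))) RAmap_inl RAev_inl.
    rewrite -[q _]/(RAev _ (RAmap R g (RAinl R _ _))) RAmap_inl RAev_inl.
    exact/esym/tens_der_inl.
  rewrite -[q _]/(RAev _ (RAmap R g (RAinr R _ _))) RAmap_inr RAev_inr.
  rewrite [LHS]tens_der_inr FG_incl_der; exact: rmorph0 (tensInr R (FG G)).
by rewrite -qd -[in RHS]aut_der [in RHS]RtensA_der_inl.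
Qed.

End PicardVessiotTorsor.

(** * Integral torsors *)

Inductive ideal_span (A : comPzRingType) (P : A -> Prop) : A -> Prop :=
| ideal_span0 : ideal_span P 0
| ideal_spanS t p x : P p -> ideal_span P x -> ideal_span P (t * p + x).

Section IdealSpan.
Variables (A : comPzRingType) (P : A -> Prop).

Lemma ideal_spanD x y : ideal_span P x -> ideal_span P y -> ideal_span P (x + y).
Proof.
elim=> [|t p z Pp _ IH] hy; first by rewrite add0r.
by rewrite -addrA; apply: ideal_spanS => //; apply: IH.
Qed.

Lemma ideal_spanM a x : ideal_span P x -> ideal_span P (a * x).
Proof.
elim=> [|t p z Pp _ IH]; first by rewrite mulr0; constructor.
by rewrite mulrDr mulrA; apply: ideal_spanS.
Qed.

Lemma mem_ideal_span p : P p -> ideal_span P p.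
Proof.
move=> Pp; have := ideal_spanS 1 Pp (ideal_span0 P).
by rewrite mul1r addr0.
Qed.

Lemma ideal_span_der (dA : derivation A) : (forall p, P p -> P (dA p)) ->
  forall x, ideal_span P x -> ideal_span P (dA x).
Proof.
move=> Pd x; elim=> [|t p z Pp _ IH]; first by rewrite der_0; constructor.
rewrite derD derM -addrA; apply: ideal_spanS => //.
by apply: ideal_spanS => //; apply: Pd.
Qed.

End IdealSpan.

Lemma field_simple_diff (L : fieldType) (dL : derivation L) : simple_diff dL.
Proof.
move=> I I0 ID IM Id; have [[x Ix x0]|nI] := pselect (exists2 x, I x & x != 0).
  by right=> y; rewrite -[y](divfK x0); apply: IM.
left=> x Ix; apply/eqP; apply: contrapT => /negP x0; apply: nI; by exists x.
Qed.

Section IntegralTorsor.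
Variables (F : fieldType) (d : derivation F).
Notation K := (constField d).
Notation resK := (resAlg (constIncl d)).
Notation resHomK := (resHom (constIncl d)).
Variables (G : linAlgGroup K) (R : diffAlg d) (a : rightAction G R).
Notation B := (coordRing G).

Hypothesis torsor_a : torsor a.
Hypothesis coact_der :
  forall x : R, coaction a (der R x) = der (tensDiffAlg R (FG G)) (coaction a x).

Variables (L : diffAlg d) (e : algHom R L).
Hypotheses (e_inj : injective e) (e_der : forall r, e (der R r) = der L (e r)).
Hypotheses (simpleL : simple_diff (der L)) (constL : constants_eq_K L).

(* For a differential ideal I of R, the ideal generated by the image of I under
   R -> R (x)_K K[G] -> L (x)_K K[G] is generated by an ideal J of K[G]. If I is
   nonzero then J contains 1, by translating back; and L (x)_K K[G] = L (x)_F R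
   turns this into 1 \in I. *)
Lemma torsor_simple_diff : simple_diff (der R).
Proof.
move=> I I0 ID IM Id.
have [[i Ii i0]|nI] := pselect (exists2 i, I i & i != 0); last first.
  by left=> x Ix; apply: contrapT => /eqP x0; apply: nI; exists x.
right; suff I1 : I 1 by move=> x; rewrite -[x]mulr1; apply: IM.
pose rho := translate a (algId B).
pose E : {rmorphism RA R B -> RA L B} := tensMap (resHomK e) (algId B).
have E_inl r : E (RAinl R B r) = RAinl L B (e r) by rewrite /= tmap_pure.
have E_inr b : E (RAinr R B b) = RAinr L B b by rewrite /= tmap_pure rmorph1.
have E_der x : E (der (RtensA R B) x) = der (RtensA L B) (E x).
  apply: RA_der_ext => r; first by rewrite !E_inl e_der [RHS]RA_der_inl.
  by rewrite E_inr [LHS]RA_der_inr.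
have rslice_E phi x : linform phi -> rslice phi (E x) = e (rslice phi x).
  move=> phiP; elim/tens_ind: x => [|r b x IH].
    by rewrite rmorph0 !rslice0 // rmorph0.
  rewrite rmorphD !rsliceD // IH rmorphD; congr (_ + _).
  by rewrite /= tmap_pure !rslice_pure // rmorphM /= algFunE.
pose P p := exists2 j, I j & p = E (rho j).
pose N := ideal_span P.
pose J b := N (RAinr L B b).
have N_der x : N x -> N (der (RtensA L B) x).
  apply: (@ideal_span_der (RtensA L B) P (der (RtensA L B))) => p [j Ij ->].
  by exists (der R j); [apply: Id|rewrite -E_der /rho (translate_der coact_der)].
have NJ x : N x -> tsub J x.
  apply: (diff_submodule_tsub constL simpleL) => //; first by constructor.
    exact: ideal_spanD.
  by move=> r y; apply: ideal_spanM.
have Js : subspace J.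
  split=> [|b b' hb hb'|c b hb]; rewrite /J ?raddf0; first by constructor.
    by rewrite raddfD; apply: ideal_spanD.
  by rewrite rmorphM; apply: ideal_spanM.
have JM b b' : J b -> J (b' * b) by move=> hb; rewrite /J rmorphM; apply: ideal_spanM.
(* Slices of [rho j] along forms killing J vanish over L, hence over R by injectivity of e, so
   [rho j] lies in $R\otimes J$ before the extension to L. *)
have rhoJ j : I j -> tsub J (rho j).
  move=> Ij; apply: tsubP => // phi phiP phiJ; apply: e_inj.
  rewrite -rslice_E // rmorph0; apply: (@tsub_rslice _ (resK L) B J phi _ phiP phiJ).
  by apply: NJ; apply: mem_ideal_span; exists j.
have mulJ (x : tens (resK R) B) b : J b -> tsub J (x * @tinr K (resK R) B b).
  move=> Jb; elim/tens_ind: x => [|r b' x IH]; first by rewrite mul0r; apply: tsub0.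
  rewrite mulrDl; apply: tsubD => //; rewrite tpureM mulr1.
  by apply: tsub_pure; apply: JM.
have sigmaJ (g : algHom B B) x : tsub J x -> tsub J (sigma a g x).
  move: x; apply: tsub_ind => [|x y hx hy|r b Jb].
  - by rewrite rmorph0; apply: tsub0.
  - by rewrite rmorphD; apply: tsubD.
  by rewrite tpure_lr rmorphM [sigma a g (tinr _ _)](sigma_inr a g); apply: mulJ.
(* Translating by the inverse of the tautological point undoes [rho]; it preserves $R\otimes J$
   because J is an ideal of K[G]. *)
have iJ : tsub J (RAinl R B i).
  have := sigmaJ (ginv (algId B)) _ (rhoJ i Ii).
  by rewrite /rho -sigma_inl -sigma_mul gmulV sigma_one.
have J1 : J 1.
  apply: contrapT => nJ1; have [phi [phiP phiJ phi1]] := separation Js nJ1.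
  have := tsub_rslice phiP phiJ iJ.
  by rewrite rslice_pure // phi1 rmorph1 mul1r => /eqP; rewrite (negbTE i0).
have [Psi [_ [Psil _ _ _ gamE]]] := torsor_iso torsor_a coact_der.
pose eR : algHom (tensAlg R R) (tensAlg L R) := tensMap e (algId R).
(* [chi] extends [Psi] to a map $L\otimes_K K[G]\to L\otimes_F R$ and sends the image of [rho r] to
   $1\otimes r$, so it carries N into the ideal generated by the $1\otimes j$ with j in I. *)
have [chi [chil chir]] := RA_extend (tensInl L R)
  (algComp (resHomK eR) (algComp (resHomK Psi) (RAinr R B))).
have chiE x : chi (E x) = eR (Psi x).
  apply: (@RA_ext _ _ R B _ (chi \o E) (algComp eR Psi)) => r.
    rewrite -[LHS]/(chi (E (RAinl R B r))) E_inl chil.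
    by rewrite -[RHS]/(eR (Psi (RAinl R B r))) Psil /= tmap_pure.
  by rewrite -[LHS]/(chi (E (RAinr R B r))) E_inr chir.
have Psi_rho r : Psi (rho r) = tensInr R R r.
  rewrite gamE [LHS]act_natE; congr (act a _ _ r); apply: algHom_ext => x //.
  exact: Psil.
apply: contrapT => nI1.
have Is : subspace I by split=> // c x; apply: IM.
(* Slicing by [la] kills this ideal but sends $1\otimes 1$ to 1; as 1 lies in N, this gives 1 = 0 in
   L, against the injectivity of e and the nonzero i. *)
have [la [laP laI la1]] := separation Is nI1.
have killI (z : tens L R) j : I j -> rslice la (z * @tinr F L R j) = 0.
  move=> Ij; elim/tens_ind: z => [|l r z IH]; first by rewrite mul0r rslice0.
  rewrite mulrDl rsliceD // IH addr0 tpureM mulr1 rslice_pure //.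
  by rewrite laI ?rmorph0 ?mul0r //; apply: IM.
have Nker x : N x -> rslice la (chi x) = 0.
  elim=> [|t p y [j Ij ->] _ IH]; first by rewrite rmorph0 rslice0.
  rewrite rmorphD rmorphM rsliceD // IH addr0 chiE Psi_rho.
  have -> : eR (tensInr R R j) = @tinr F L R j by rewrite /= tmap_pure rmorph1.
  exact: killI.
have := Nker _ J1; rewrite rmorph1 [chi _]rmorph1 rslice_pure // la1 rmorph1 mulr1.
move=> L1; case/negP: i0; apply/eqP/e_inj.
by rewrite rmorph0 -[LHS]mulr1 L1 mulr0.
Qed.

End IntegralTorsor.

(** * Assembly of the implications and reduction of the integral case to the simple one *)

Section MainTheorem.
Variables (F : fieldType) (d : derivation F) (G : linAlgGroup (constField d)).
Variable R : diffAlg d.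

Lemma diff_torsor_of_galois_group : (1 : R) != 0 -> picard_vessiot R ->
  galois_group R G -> diff_torsor G R.
Proof.
move=> R1 [[n [Z [W [u [[n0 [ZW WZ]] [M dZ] uZ gen]]]]] simpleR constR].
case=> theta [theta_bij thetaM theta_nat].
exact: (galois_diff_torsor ZW WZ dZ uZ gen simpleR constR R1 theta_bij thetaM theta_nat).
Qed.

Lemma picard_vessiot_of_simple_torsor : [pchar F] =i pred0 -> constants_eq_K R ->
  simple_diff_torsor G R -> picard_vessiot R /\ galois_group R G.
Proof.
move=> charF constR [[a [ta coact]] simpleR]; split.
  exact: (torsor_picard_vessiot ta coact).
exact: (torsor_galois_group ta coact).
Qed.

End MainTheorem.

Theorem corollary1p14 (F : fieldType) (d : derivation F)
    (G : linAlgGroup (constField d)) :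
  [pchar F] =i pred0 ->
  (forall (R : comNzRingType) (dR : derivation R) (i : {rmorphism F -> R})
      (iP : forall c : F, dR (i c) = i (d c)),
    let RF := mkDiffAlg iP in
    constants_eq_K RF ->
    ((picard_vessiot RF /\ galois_group RF G) <-> simple_diff_torsor G RF))
  /\
  (forall (R : idomainType) (dR : derivation R) (i : {rmorphism F -> R})
      (iP : forall c : F, dR (i c) = i (d c)),
    let RF := mkDiffAlg iP in
    constants_eq_K (fracDiffAlg iP) ->
    ((picard_vessiot RF /\ galois_group RF G) <-> diff_torsor G RF)).
Proof.
move=> charF; split=> R dR i iP RF constR.
  have R1 : (1 : RF) != 0 := oner_neq0 R.
  split=> [[pv gal]|]; last exact: picard_vessiot_of_simple_torsor.
  by split; [apply: diff_torsor_of_galois_group|case: pv].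
have R1 : (1 : RF) != 0 := oner_neq0 R.
split=> [[pv gal]|tors]; first exact: diff_torsor_of_galois_group.
pose LF := fracDiffAlg iP.
pose e : algHom RF LF := @AlgHom F RF LF (@FracField.tofrac R) (fun=> erefl).
have e_inj : injective e by move=> x y /eqP; rewrite tofrac_eq => /eqP.
have e_der r : e (der RF r) = der LF (e r) by apply/esym/fracDer_tofrac.
(* R embeds differentially in Frac(R), so a constant of R agrees there with an element of K, and
   hence does so in R. *)
have constRF : constants_eq_K RF.
  move=> x; split=> [dx|[c ->]]; last by rewrite derMap constInclP rmorph0.
  have /constR [c xc] : der LF (e x) = 0 by rewrite -e_der dx rmorph0.
  by exists c; apply: e_inj.
apply: picard_vessiot_of_simple_torsor => //; split=> //.
case: tors => a [ta coact].
(* The key fact is available over Frac(R), since a field has no nontrivial ideals. *)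
apply: (torsor_simple_diff ta coact e_inj e_der) => //.
exact: field_simple_diff.
Qed.
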